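(* Assume the Hardy-Littlewood Conjecture. Let $\beta>0$ be an even integer, let $D=\pm 2^\sigma p_1\cdots p_r(q_1\cdots q_s)^2(l_1\cdots l_t)^3$ with $D$ odd or $4\parallel D$, and let $D=d\bar d$ and the associated quantities be as in the context. (1) If $d=1$, then $$\mathrm{dens}_D(2\beta)=\mathrm{dens}_D(-2\beta)=\frac14\left(1-\frac{(-1)^{r+t}}{\tau(p_1\cdots p_rl_1\cdots l_t)}\right).$$ (2) If $\bar d$ has no odd prime factor, then $\mathrm{dens}_D(2\beta)=\mathrm{dens}_D(-2\beta)=0$. (3) If $\bar d$ has some odd prime factor, then $$\mathrm{dens}_D(2\beta)=\mathrm{dens}_D(-2\beta)=\frac14\left(1-\frac{(-1)^{r''+t''}}{\tau(\bar d_p\bar d_l)}\right).$$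
   Context: $D=\pm 2^\sigma p_1\cdots p_r(q_1\cdots q_s)^2(l_1\cdots l_t)^3$ with $\sigma\in\{0,1,2,3\}$, $r,s,t\ge0$, and the $p_i,q_i,l_i$ pairwise distinct odd primes. Write $D=d\bar d$ with $\gcd(d,\bar d)=1$, $d>0$ odd, every prime factor of $d$ dividing $\beta$, and no odd prime factor of $\bar d$ dividing $\beta$. Write $\bar d=\pm2^\sigma\bar d_p\bar d_q^2\bar d_l^3$ with $\bar d_p,\bar d_q,\bar d_l$ positive, odd, squarefree and pairwise coprime; $r'',t''$ are the numbers of prime factors of $\bar d_p,\bar d_l$ respectively. On odd squarefree positive integers, $\tau(n)=\prod_{l\mid n}\tau(l)$ with $\tau(l)=l$ if $l\equiv3\pmod4$, $\tau(l)=l-2$ if $l\equiv1\pmod4$, and $\tau(1)=1$. $2^k\parallel D$ means $2^k\mid D$ and $2^{k+1}\nmid D$. For a nonzero integer $D$, $E_D$ is the elliptic curve $y^2=x^3+Dx$, and for a prime $p\nmid 2D$, $a_p(E_D)=1+p-\#\tilde E_D(\mathbb{F}_p)$. For a nonzero integer $m$ put $Q(m,N)=\{p \text{ prime}: p=m^2+x^2\le N \text{ for some } x\in\mathbb{Z}\}$ and $$\mathrm{dens}_D(2m)=\lim_{N\to\infty}\frac{\#\{p\in Q(m,N): p\nmid 2D,\ a_p(E_D)=2m\}}{\#Q(m,N)}$$ (denoted $a_p(2m)$ in the paper); the claim includes that the limits exist. Hardy-Littlewood Conjecture: for all integers $a,b,c$ with $a>0$, $\gcd(a,b,c)=1$,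 $a+b$ and $c$ not both even, and $\Delta=b^2-4ac$ not a perfect square, the number $P(n)$ of primes less than $n$ of the form $ax^2+bx+c$ (with $x$ a nonnegative integer) satisfies $P(n)\sim\delta(a,b,c)\frac{\sqrt{n}}{\log n}$ as $n\to\infty$, where $$\delta(a,b,c)=\frac{\gcd(2,a+b)}{\sqrt{a}}\prod_{p\mid a,\ p\mid b,\ p>2}\frac{p}{p-1}\ \prod_{p\nmid a,\ p>2}\left(1-\frac{\left(\frac{\Delta}{p}\right)}{p-1}\right),$$ the products being over primes (the second taken in increasing order of $p$) and $\left(\frac{\cdot}{p}\right)$ being the Legendre symbol. *)

(* Defs.v *)
From mathcomp Require Import all_boot all_order all_algebra.
From mathcomp Require Import all_classical all_reals all_analysis.

Set Implicit Arguments.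
Unset Strict Implicit.
Unset Printing Implicit Defensive.

Import Order.TTheory GRing.Theory Num.Theory.
Import numFieldNormedType.Exports.

Local Open Scope classical_set_scope.
Local Open Scope ring_scope.

(** Arithmetic *)

Definition squarefree (n : nat) : Prop := forall k : nat, (k ^ 2 %| n)%N -> k = 1%N.

(* 2^k || D *)
Definition pow2_exactly_divides (k : nat) (D : int) : bool :=
  ((2 ^ k)%N%:Z %| D)%Z && ~~ ((2 ^ k.+1)%N%:Z %| D)%Z.

(* For p prime and odd. *)
Definition legendre (a : int) (p : nat) : int :=
  if a%:~R == 0 :> 'F_p then 0
  else if [exists x : 'F_p, x ^+ 2 == a%:~R] then 1 else -1.

Definition tau_prime (l : nat) : nat := if (l %% 4 == 3)%N then l else (l - 2)%N.

(* [primes n] lists each prime factor once; meant for odd squarefree n > 0. *)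
Definition tau (n : nat) : nat := (\prod_(l <- primes n) tau_prime l)%N.

(** The curve E_D : y^2 = x^3 + D x *)

(* The points of the reduction of E_D modulo p; [None] is the point at
   infinity. *)
Definition E_points (D : int) (p : nat) : {set option ('F_p * 'F_p)} :=
  [set P : option ('F_p * 'F_p) |
    if P is Some (x, y) then y ^+ 2 == x ^+ 3 + D%:~R * x else true].

Definition frob_trace (D : int) (p : nat) : int := 1 + p%:Z - #|E_points D p|%:Z.

Definition Q (m : int) (N : nat) : {set 'I_N.+1} :=
  [set p : 'I_N.+1 | prime p &&
    `[< exists x : int, p%:Z = m ^+ 2 + x ^+ 2 >]].

(* dens_D(2m) is the limit of [dens_ratio R D m N] as N tends to infinity. *)
Definition dens_ratio (R : realType) (D m : int) (N : nat) : R :=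
  #|[set p in Q m N | ~~ (p%:Z %| 2 * D)%Z && (frob_trace D p == 2 * m)]|%:R
  / #|Q m N|%:R.

(** The Hardy-Littlewood Conjecture *)

(* The number of primes less than n of the form a x^2 + b x + c, x >= 0. *)
Definition HL_count (a b c : int) (n : nat) : nat :=
  #|[set p : 'I_n | prime p &&
      `[< exists x : nat, p%:Z = a * x%:Z ^+ 2 + b * x%:Z + c >]]|.

Definition disc (a b c : int) : int := b ^+ 2 - 4 * a * c.

Definition HL_delta (R : realType) (a b c : int) : R :=
  (gcdz 2 (a + b))%:~R / Num.sqrt a%:~R
  * (\prod_(p <- primes `|a|%N | (p%:Z %| b)%Z && (2 < p)%N) (p%:R / (p%:R - 1)))
  * lim ((fun n : nat =>
      \prod_(0 <= p < n | [&& prime p, ~~ (p%:Z %| a)%Z & (2 < p)%N])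
        (1 - (legendre (disc a b c) p)%:~R / (p%:R - 1) : R)) @ \oo).

(* Asymptotic equivalence is expressed as "the quotient tends to 1".  As [lim]
   is 0 for a divergent sequence, this forces the infinite product in
   [HL_delta] to converge to a nonzero limit. *)
Definition Hardy_Littlewood_conjecture (R : realType) : Prop :=
  forall a b c : int,
    0 < a ->
    gcdz (gcdz a b) c = 1 ->
    ~~ ((2 %| a + b)%Z && (2 %| c)%Z) ->
    ~ (exists k : int, disc a b c = k ^+ 2) ->
    (fun n : nat => (HL_count a b c n)%:R
       / (HL_delta R a b c * (Num.sqrt n%:R / ln n%:R)) : R) @ \oo --> (1 : R).

(* Main.v *)
Require Import Defs.
From mathcomp Require Import all_boot all_order all_algebra cyclic all_field.
From mathcomp Require Import all_classical all_reals all_analysis.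
From mathcomp Require Import ring zify.

Set Implicit Arguments.
Unset Strict Implicit.
Unset Printing Implicit Defensive.

Import Order.TTheory GRing.Theory Num.Theory.
Import numFieldNormedType.Exports.

Local Open Scope ring_scope.

(** Fix [b = beta] and let [p = x ^ 2 + b ^ 2] be an odd prime, so that [x] is
    odd and [p] is 1 modulo 4. Let [chi] be the quartic character modulo [p]
    for which the square root [b / x] of -1 modulo [p] stands for [i], and [J]
    the Jacobi sum of [chi] with itself. Counting the points of
    [y ^ 2 = x ^ 3 + D x] gives [a_p = - 2 Re (conj (chi D) J)]
    ([frob_trace_jacobi]). The Gaussian integer [J] has norm [p], vanishes
    under [i |-> b / x], and its class modulo [2 + 2 i] is known; hence
    [J = + (x + i b)] or [J = - (x + i b)], with a sign that depends only on
    [x] modulo 4 ([two_squares_jacobi]). So [a_p] is [2 b] or [- 2 b] exactly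
    when [D] is a quadratic nonresidue modulo [p], and which of the two it is
    depends on [chi D] and on that sign.

    Frequency of nonresidues. By quadratic reciprocity the quadratic character
    of [D] modulo [p] is the product of the symbols [((x ^ 2 + b ^ 2) / q)] over
    the odd primes [q] with odd exponent in [D]; if [q] divides [b] the symbol
    is 1. The conjecture, applied to [(M y + c) ^ 2 + b ^ 2] with [M] four times
    the product of the odd primes dividing [D], has the same constant for every
    admissible class [c] ([HL_delta_class]), so these classes are equally
    frequent and only classes have to be counted. By the Chinese remainder
    theorem the count is local: for [q] prime to [b], the symbol has sum [-1]
    over the [tau q] values of [x] modulo [q] with [x ^ 2 + b ^ 2] nonzero
    ([sum_class_symbol]). The mean of the quadratic character of [D] is
    therefore the product of the [- 1 / tau q].

    Equidistribution of the sign. Let [G] be the Gauss sum of [chi], taken in a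
    field of characteristic an odd prime [q]. There [G ^ 4 = p J ^ 2], and the
    Frobenius map sends [G] to the Gauss sum of [chi] or of its conjugate, up to
    a value of [chi] at [q]. This expresses [chi q] through [x + i b] modulo
    [q], and shows that replacing [x] by [- x] modulo [q] conjugates [chi q]
    ([quartic_char_pair]). The characters of -1 and 4 are real and depend only
    on [b]; here it matters that 2 divides [D] zero or two times. So multiplying
    a class by a number that is 1 modulo 4 and -1 modulo the odd part of [M]
    exchanges the classes with [a_p = 2 b] and those with [a_p = - 2 b]
    ([class_sign_reflect]), and each of the two signs takes half of the
    nonresidue classes ([card_sign_classesE]).

    The three cases of the theorem are one formula: the set of primes [q] is
    read off from the given factorization of [D] or from that of [dbar]. *)

(** * Quadratic characters of prime fields *)

Definition qchar (p : nat) (u : 'F_p) : int :=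
  if u == 0 then 0 else if u ^+ p.-1./2 == 1 then 1 else -1.

Lemma fermat (p : nat) (u : 'F_p) : prime p -> u != 0 -> u ^+ p.-1 = 1.
Proof.
move=> pr u0; apply: (mulfI u0).
by rewrite -exprS prednK ?prime_gt0 // mulr1 -{2}(expf_card u) card_Fp.
Qed.

Lemma odd_prime_double (p : nat) : odd p -> p.-1./2.*2 = p.-1.
Proof. by move=> op; lia. Qed.

Lemma prime_two_neq0 (p : nat) : prime p -> odd p -> (2 : 'F_p) != 0.
Proof.
move=> pr op; rewrite -(dvdn_pcharf (pchar_Fp pr)) gtnNdvd //.
exact: odd_prime_gt2.
Qed.

Lemma eq_oppr_neq0 (p : nat) (u : 'F_p) : prime p -> odd p -> u != 0 -> u != - u.
Proof.
move=> pr op u0; rewrite -subr_eq0 opprK -mulr2n -mulr_natl mulf_eq0 negb_or u0.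
by rewrite prime_two_neq0.
Qed.

Lemma Fp_primitive_root (p : nat) :
  prime p -> exists g : 'F_p, p.-1.-primitive_root g.
Proof.
move=> pr; have p1 := prime_gt1 pr.
have := @has_prim_root 'F_p p.-1 (enum [pred x : 'F_p | x != 0]).
case/(_ _ _ _ _)/hasP; first by rewrite -subn1 subn_gt0.
- apply/allP=> x; rewrite mem_enum inE => x0.
  by rewrite unity_rootE (fermat pr x0).
- exact: enum_uniq.
- by rewrite -cardE (cardC1 (0 : 'F_p)) card_Fp.
by move=> g _ gP; exists g.
Qed.

Lemma qchar_sqr (p : nat) (z : 'F_p) :
  prime p -> odd p -> z != 0 -> qchar (z ^+ 2) = 1.
Proof.
move=> pr op z0; rewrite /qchar sqrf_eq0 (negPf z0) -exprM mul2n.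
by rewrite odd_prime_double // fermat ?eqxx.
Qed.

Lemma qchar1 (p : nat) : prime p -> odd p -> qchar (1 : 'F_p) = 1.
Proof. by move=> pr op; rewrite -(expr1n _ 2) qchar_sqr ?oner_eq0. Qed.

Lemma half_power_pm1 (p : nat) (u : 'F_p) :
  prime p -> odd p -> u != 0 -> (u ^+ p.-1./2 == 1) || (u ^+ p.-1./2 == -1).
Proof.
move=> pr op u0; rewrite -eqf_sqr expr1n -exprM muln2.
by rewrite odd_prime_double // fermat.
Qed.

Lemma qcharE (p : nat) (u : 'F_p) :
  prime p -> odd p -> (qchar u)%:~R = u ^+ p.-1./2 :> 'F_p.
Proof.
move=> pr op; rewrite /qchar; have p3 := odd_prime_gt2 op pr.
case: eqP => [->|/eqP u0].
  by rewrite expr0n (_ : (p.-1./2 == 0)%N = false) //; lia.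
by case/orP: (half_power_pm1 pr op u0) => /eqP ->; rewrite ?eqxx //; case: eqP => // ->.
Qed.

Lemma qcharM (p : nat) (u v : 'F_p) :
  prime p -> odd p -> qchar (u * v) = qchar u * qchar v.
Proof.
move=> pr op; rewrite /qchar mulf_eq0.
have [//|u0] /= := eqVneq u 0; first by rewrite mul0r.
have [//|v0] /= := eqVneq v 0; first by rewrite mulr0.
have n1 : (-1 == 1 :> 'F_p) = false.
  by apply/negbTE; rewrite eq_sym eq_oppr_neq0 ?oner_eq0.
rewrite exprMn.
by case/orP: (half_power_pm1 pr op u0) => /eqP ->;
  case/orP: (half_power_pm1 pr op v0) => /eqP ->;
  rewrite ?mulrNN ?mulr1 ?mul1r ?eqxx ?n1.
Qed.

Lemma qchar_sqrtP (p : nat) (u : 'F_p) :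
  prime p -> odd p -> u ^+ p.-1./2 = 1 -> exists z : 'F_p, u = z ^+ 2.
Proof.
move=> pr op u1; have [g gP] := Fp_primitive_root pr.
have p3 := odd_prime_gt2 op pr.
have /(prim_rootP gP)[[i ip] /= def_u]: u ^+ p.-1 = 1.
  by rewrite -odd_prime_double // -muln2 exprM u1 expr1n.
move: u1; rewrite def_u -exprM => /eqP; rewrite -(prim_order_dvd gP).
rewrite -{1}(odd_prime_double op) -mul2n dvdn_pmul2r; last by lia.
by case/dvdnP=> j ->; exists (g ^+ j); rewrite -exprM.
Qed.

Lemma card_sqrt (p : nat) (c : 'F_p) :
  prime p -> odd p -> #|[set y : 'F_p | y ^+ 2 == c]|%:Z = 1 + qchar c.
Proof.
move=> pr op; have [c0|c0] := eqVneq c 0.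
  rewrite c0 /qchar eqxx addr0 (_ : [set y : 'F_p | _] = [set 0]) ?cards1 //.
  by apply/setP=> y; rewrite !inE sqrf_eq0.
have [c1|c1] := eqVneq (c ^+ p.-1./2) 1.
  have [z def_c] := qchar_sqrtP pr op c1.
  have z0 : z != 0 by apply: contraNneq c0 => z0; rewrite def_c z0 expr0n.
  rewrite (_ : [set y : 'F_p | _] = [set z; - z]%SET); last first.
    by apply/setP=> y; rewrite !inE def_c eqf_sqr.
  by rewrite cards2 eq_oppr_neq0 // def_c qchar_sqr.
rewrite (_ : [set y : 'F_p | _] = finset.set0).
  by rewrite cards0 /qchar (negPf c0) (negPf c1).
apply/setP=> y; rewrite !inE; apply/negbTE; apply: contra c1 => /eqP y2.
rewrite -y2 -exprM mul2n odd_prime_double // fermat //.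
by apply: contraNneq c0 => y0; rewrite -y2 y0 expr0n.
Qed.

(** Each [c] has [1 + qchar c] square roots. This reduces sums over squares to
    sums over the field in the evaluation of Jacobi sums, of point counts and of
    the local densities. *)
Lemma sum_over_squares (p : nat) (K : comPzRingType) (g : 'F_p -> K) :
  prime p -> odd p ->
  \sum_y g (y ^+ 2) = \sum_c g c * (1 + qchar c)%:~R.
Proof.
move=> pr op; rewrite (partition_big (fun y : 'F_p => y ^+ 2) xpredT) //=.
apply: eq_bigr => c _.
rewrite -card_sqrt // -sum1_card (eq_bigl (fun y => y ^+ 2 == c)); last first.
  by move=> y; rewrite ?inE.
rewrite (eq_bigr (fun=> g c)); last by move=> y /eqP ->.
rewrite sumr_const -mulr_natr; congr (_ * _).
rewrite -[RHS]/((_ : nat)%:R) sum1_card.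
by congr (_%:R); apply: eq_card => y; rewrite !inE.
Qed.

Lemma sum_qchar (p : nat) : prime p -> odd p -> \sum_(c : 'F_p) qchar c = 0.
Proof.
move=> pr op.
have := sum_over_squares (fun=> 1 : int) pr op.
under [RHS]eq_bigr do rewrite mul1r intz.
by rewrite big_split /= => /eqP; rewrite eq_sym addrC -subr_eq0 addrK => /eqP.
Qed.

(** * Gauss and Jacobi sums with values in an arbitrary field *)

Section GaussSums.

Variables (p : nat) (K : fieldType) (z : K).
Hypotheses (pr : prime p) (zP : p.-primitive_root z).

Definition addchar (t : 'F_p) : K := z ^+ t.

Lemma addchar_nat (n : nat) : addchar n%:R = z ^+ n.
Proof. by rewrite /addchar val_Fp_nat // (prim_expr_mod zP). Qed.

Lemma addcharD (s t : 'F_p) : addchar (s + t) = addchar s * addchar t.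
Proof. by rewrite -[s in LHS]natr_Zp -[t in LHS]natr_Zp -natrD addchar_nat exprD. Qed.

Lemma addchar_natmul (n : nat) (t : 'F_p) : addchar (n%:R * t) = addchar t ^+ n.
Proof.
by rewrite -[t in LHS]natr_Zp -natrM addchar_nat mulnC exprM.
Qed.

Lemma addchar_eq1 (t : 'F_p) : (addchar t == 1) = (t == 0).
Proof.
rewrite -[t in LHS]natr_Zp addchar_nat -(prim_order_dvd zP).
by rewrite (dvdn_pcharf (pchar_Fp pr)) natr_Zp.
Qed.

Lemma sum_addchar (u : 'F_p) :
  \sum_t addchar (u * t) = if u == 0 then p%:R else 0.
Proof.
have [->|u0] := eqVneq u 0.
  under eq_bigr do rewrite mul0r /addchar expr0.
  by rewrite sumr_const -[X in _ *+ X]/(#|'F_p|) card_Fp.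
set S := \sum_t _; have: addchar u * S = S.
  rewrite /S [RHS](reindex_inj (addrI 1)) mulr_sumr.
  by apply: eq_bigr => t _; rewrite mulrDr mulr1 addcharD.
move/eqP; rewrite -[X in _ == X]mul1r -subr_eq0 -mulrBl mulf_eq0 subr_eq0.
by rewrite addchar_eq1 (negPf u0) => /eqP.
Qed.

(** Multiplicative characters extended by 0, with no restriction on the values,
    so that the same sums can be formed over the complex numbers, in
    characteristic [q] and in [F_p] itself. *)
Definition mulchar (chi : 'F_p -> K) :=
  [/\ chi 0 = 0, chi 1 = 1 & {morph chi : s t / s * t}].

Definition gauss (chi : 'F_p -> K) := \sum_t chi t * addchar t.

Definition jacobi (chi psi : 'F_p -> K) := \sum_t chi t * psi (1 - t).

Lemma sum_mulchar (chi : 'F_p -> K) (t0 : 'F_p) :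
  mulchar chi -> t0 != 0 -> chi t0 != 1 -> \sum_t chi t = 0.
Proof.
move=> [_ _ chiM] t00 chi_t0; apply/eqP.
rewrite -(mulrI_eq0 _ (_ : GRing.lreg (chi t0 - 1))); last first.
  by apply/mulfI; rewrite subr_eq0.
rewrite mulrBl mul1r subr_eq0 mulr_sumr [X in _ == X](reindex_inj (mulfI t00)).
by apply/eqP/eq_bigr => t _; rewrite chiM.
Qed.

(** Collecting the terms of the product of two Gauss sums by [u = s + t], the
    coefficient of [addchar u] is homogeneous in [u]. *)
Lemma gaussM (chi psi omega : 'F_p -> K) :
    mulchar chi -> mulchar psi -> (forall t, omega t = chi t * psi t) ->
    \sum_t omega t = 0 ->
  gauss chi * gauss psi = jacobi chi psi * gauss omega.
Proof.
move=> [chi0 _ chiM] [psi0 _ psiM] omegaE sum0.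
transitivity (\sum_u (\sum_s chi s * psi (u - s)) * addchar u).
  rewrite /gauss mulr_suml.
  under [RHS]eq_bigr do rewrite mulr_suml.
  rewrite [RHS]exchange_big /=; apply: eq_bigr => s _.
  rewrite [RHS](reindex_inj (addrI s)) mulr_sumr; apply: eq_bigr => t _.
  by rewrite addrC addKr addcharD; ring.
rewrite /gauss mulr_sumr; apply: eq_bigr => u _; rewrite mulrA; congr (_ * _).
have [->|u0] := eqVneq u 0.
  rewrite omegaE chi0 mul0r mulr0.
  transitivity (psi (-1) * \sum_t omega t); last by rewrite sum0 mulr0.
  rewrite mulr_sumr; apply: eq_bigr => s _.
  by rewrite sub0r -[- s]mulN1r psiM omegaE; ring.
rewrite (reindex_inj (mulfI u0)) /jacobi mulr_suml; apply: eq_bigr => s _.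
by rewrite -{2}(mulr1 u) -mulrBr chiM psiM omegaE; ring.
Qed.

(** Here the products [chi s * psi t] depend only on the ratio [v = s / t], and
    summing over [t] first isolates [v = -1]. *)
Lemma gauss_conj (chi psi : 'F_p -> K) :
    mulchar chi -> mulchar psi -> (forall t, t != 0 -> chi t * psi t = 1) ->
    \sum_t chi t = 0 ->
  gauss chi * gauss psi = chi (-1) * p%:R.
Proof.
move=> [chi0 _ chiM] [psi0 _ psiM] chipsi sum0.
transitivity (\sum_(t | t != 0) \sum_v chi v * addchar ((v + 1) * t)).
  rewrite /gauss mulrC mulr_suml (bigD1 0) //= psi0 !mul0r add0r.
  apply: eq_bigr => t t0; rewrite mulr_sumr (reindex_inj (mulIf t0)).
  apply: eq_bigr => v _; rewrite chiM mulrDl mul1r addcharD.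
  by rewrite -[RHS]mulr1 -(chipsi _ t0); ring.
rewrite exchange_big /=.
transitivity (\sum_v chi v * ((if v + 1 == 0 then p%:R else 0) - 1)).
  apply: eq_bigr => v _; rewrite -sum_addchar [in RHS](bigD1 (0 : 'F_p)) //= -mulr_sumr.
  by rewrite mulr0 [addchar 0]expr0 [1 + _]addrC addrK.
under eq_bigr do rewrite mulrBr mulr1.
rewrite big_split /= sumrN sum0 subr0 (bigD1 (-1)) //= addNr eqxx.
rewrite big1 ?addr0 // => v v1.
by rewrite addr_eq0 (negPf v1) mulr0.
Qed.

(** Raising to the power [q] in characteristic [q] is additive, so it only
    twists the two characters. *)
Lemma gauss_frobenius (q : nat) (chi psi : 'F_p -> K) :
    q \in [pchar K] -> (q%:R : 'F_p) != 0 ->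
    mulchar psi -> (forall t, psi t = chi t ^+ q) ->
  psi q%:R * gauss chi ^+ q = gauss psi.
Proof.
move=> qP q0 [_ _ psiM] psiE.
rewrite -(pFrobenius_autE qP) rmorph_sum mulr_sumr.
rewrite [RHS](reindex_inj (mulfI q0)); apply: eq_bigr => t _.
by rewrite /= pFrobenius_autE exprMn -psiE -addchar_natmul psiM mulrA.
Qed.

End GaussSums.

(** * The quartic character modulo a prime congruent to 1 modulo 4 *)

Lemma gaussian_mul (K : comPzRingType) (i a b c d : K) : i ^+ 2 = -1 ->
  (a + b * i) * (c + d * i) = a * c - b * d + (a * d + b * c) * i.
Proof.
move=> i2; transitivity (a * c + b * d * i ^+ 2 + (a * d + b * c) * i); first by ring.
by rewrite i2; ring.
Qed.

Lemma odd_mod4_1 (n : nat) : (n %% 4 = 1)%N -> odd n. Proof. by lia. Qed.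

Section QuarticCharacter.

Variables (p : nat) (iota : 'F_p).
Hypotheses (pr : prime p) (p1 : (p %% 4 = 1)%N) (iota2 : iota ^+ 2 = -1).

(** A fourth root of unity in a field containing a square root [i] of -1 is
    kept as its pair of coordinates along 1 and [i], which are integers, so
    that one and the same character takes values in every field. *)
Definition qre (t : 'F_p) : int :=
  let w := t ^+ (p %/ 4) in (w == 1)%:R - (w == -1)%:R.
Definition qim (t : 'F_p) : int :=
  let w := t ^+ (p %/ 4) in (w == iota)%:R - (w == - iota)%:R.

Definition qchi (K : pzRingType) (i : K) (t : 'F_p) : K :=
  (qre t)%:~R + (qim t)%:~R * i.

Let op := odd_mod4_1 p1.

Lemma prime1_quarter_gt0 : (0 < p %/ 4)%N.
Proof. by have := prime_gt1 pr; lia. Qed.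

Lemma iota_neq0 : iota != 0.
Proof.
by apply: contra_eqN iota2 => /eqP ->; rewrite expr0n eq_sym oppr_eq0 oner_eq0.
Qed.

Lemma fourth_roots_distinct :
  ((1 == -1 :> 'F_p) = false) * ((-1 == 1 :> 'F_p) = false) *
  ((1 == iota) = false) * ((1 == - iota) = false) *
  ((-1 == iota) = false) * ((-1 == - iota) = false) *
  ((iota == 1) = false) * ((iota == -1) = false) *
  ((- iota == 1) = false) * ((- iota == -1) = false) *
  ((iota == - iota) = false) * ((- iota == iota) = false).
Proof.
have n1 : (1 == -1 :> 'F_p) = false by apply/negbTE/eq_oppr_neq0/oner_neq0.
have n2 : (1 == iota) = false.
  by apply/eqP => e1; move: iota2 n1; rewrite -e1 expr1n => <-; rewrite eqxx.
have n3 : (1 == - iota) = false.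
  by apply/eqP => e1; move: iota2 n1; rewrite -sqrrN -e1 expr1n => <-; rewrite eqxx.
have n4 : (iota == - iota) = false by apply/negbTE/eq_oppr_neq0/iota_neq0.
have n5 : (-1 == iota) = false by rewrite eqr_oppLR.
have n6 : (-1 == - iota) = false by rewrite eqr_opp.
by do !split; rewrite // eq_sym.
Qed.

Lemma quarter_power (t : 'F_p) : t != 0 ->
  let w := t ^+ (p %/ 4) in [|| w == 1, w == iota, w == -1 | w == - iota].
Proof.
move=> t0 /=; set w := t ^+ _; have /eqP: w ^+ 4 = 1.
  by rewrite -exprM (_ : (_ * 4 = p.-1)%N) ?fermat //; lia.
rewrite (exprM w 2 2) -[X in _ == X](expr1n _ 2) eqf_sqr -iota2.
rewrite -[X in (_ == X) || _](expr1n _ 2) !eqf_sqr.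
by rewrite iota2; case: (w == 1); case: (w == iota); case: (w == -1); case: (w == _).
Qed.

Lemma quarter_power0 : (0 : 'F_p) ^+ (p %/ 4) = 0.
Proof. by rewrite expr0n eqn0Ngt prime1_quarter_gt0. Qed.

Lemma qre0 : qre 0 = 0.
Proof.
by rewrite /qre quarter_power0 eq_sym oner_eq0 eq_sym oppr_eq0 oner_eq0.
Qed.

Lemma qim0 : qim 0 = 0.
Proof.
by rewrite /qim quarter_power0 eq_sym (negPf iota_neq0) eq_sym oppr_eq0 (negPf iota_neq0).
Qed.

Lemma qre1 : qre 1 = 1.
Proof. by rewrite /qre expr1n eqxx fourth_roots_distinct. Qed.

Lemma qim1 : qim 1 = 0.
Proof. by rewrite /qim expr1n !fourth_roots_distinct. Qed.

(** The coordinates determine the power residue, which turns each of the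
    identities below into an inspection of four cases. *)
Variant quartic_spec (t : 'F_p) : int -> int -> 'F_p -> Type :=
| Quartic1 : quartic_spec t 1 0 1
| QuarticI : quartic_spec t 0 1 iota
| QuarticN1 : quartic_spec t (-1) 0 (-1)
| QuarticNI : quartic_spec t 0 (-1) (- iota).

Lemma quarticP (t : 'F_p) : t != 0 ->
  quartic_spec t (qre t) (qim t) (t ^+ (p %/ 4)).
Proof.
move=> t0; rewrite /qre /qim; have := quarter_power t0; set w := t ^+ _ => /=.
have [->|_ /=] := eqVneq w 1; first by rewrite !fourth_roots_distinct; constructor.
have [->|_ /=] := eqVneq w iota; first by rewrite !fourth_roots_distinct; constructor.
have [->|_ /= /eqP ->] := eqVneq w (-1).
  by rewrite !fourth_roots_distinct; constructor.
by rewrite eqxx; constructor.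
Qed.

Lemma qre_qimM (s t : 'F_p) :
  qre (s * t) = qre s * qre t - qim s * qim t /\
  qim (s * t) = qre s * qim t + qim s * qre t.
Proof.
have [->|s0] := eqVneq s 0; first by rewrite !mul0r qre0 qim0 !mul0r.
have [->|t0] := eqVneq t 0; first by rewrite !mulr0 qre0 qim0 !mulr0.
rewrite [qre (s * t)]/qre [qim (s * t)]/qim exprMn.
have ii : iota * iota = -1 by rewrite -expr2.
by case: (quarticP s0); case: (quarticP t0);
  rewrite ?(mulrN, mulNr, mulr1, mul1r, opprK, ii) ?eqxx ?fourth_roots_distinct.
Qed.

Lemma qnorm1 (t : 'F_p) : t != 0 -> qre t ^+ 2 + qim t ^+ 2 = 1.
Proof. by move=> t0; case: (quarticP t0). Qed.

Lemma qcharE_quartic (t : 'F_p) : qchar t = qre t ^+ 2 - qim t ^+ 2.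
Proof.
have [->|t0] := eqVneq t 0; first by rewrite qre0 qim0 /qchar eqxx.
rewrite /qchar (negPf t0) (_ : p.-1./2 = p %/ 4 * 2)%N; last by lia.
rewrite exprM; case: (quarticP t0);
  by rewrite ?sqrrN ?iota2 ?expr1n ?eqxx ?fourth_roots_distinct.
Qed.

Lemma qchiM (K : comPzRingType) (i : K) : i ^+ 2 = -1 ->
  {morph qchi i : s t / s * t}.
Proof.
move=> i2 s t; rewrite /qchi; have [-> ->] := qre_qimM s t.
by rewrite gaussian_mul // -!rmorphM -rmorphB -rmorphD.
Qed.

Lemma qchi_mulchar (K : fieldType) (i : K) : i ^+ 2 = -1 -> mulchar (qchi i).
Proof.
move=> i2; split; last exact: qchiM.
  by rewrite /qchi qre0 qim0 mul0r addr0.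
by rewrite /qchi qre1 qim1 mul0r addr0.
Qed.

Lemma qchi_conj (K : comPzRingType) (i : K) (t : 'F_p) : i ^+ 2 = -1 -> t != 0 ->
  qchi i t * qchi (- i) t = 1.
Proof.
move=> i2 t0; have := qnorm1 t0; rewrite /qchi.
move: (qre t) (qim t) => a b ab; rewrite mulrN -mulNr gaussian_mul //.
by rewrite -[RHS]/(1%:~R) -ab rmorphD !rmorphXn /=; ring.
Qed.

Lemma qchi_sqr (K : comPzRingType) (i : K) (t : 'F_p) : i ^+ 2 = -1 ->
  qchi i t ^+ 2 = (qchar t)%:~R.
Proof.
move=> i2; rewrite expr2 -qchiM // qcharE_quartic /qchi.
have [-> ->] := qre_qimM t t.
have [->|t0] := eqVneq t 0; first by rewrite qre0 qim0 !mul0r !addr0.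
by case: (quarticP t0); rewrite ?mul0r ?addr0.
Qed.

Lemma qchi_cube (K : comPzRingType) (i : K) (t : 'F_p) : i ^+ 2 = -1 ->
  qchi i t ^+ 3 = qchi (- i) t.
Proof.
move=> i2; have [->|t0] := eqVneq t 0.
  by rewrite /qchi qre0 qim0 !mul0r addr0 expr0n.
rewrite /qchi; case: (quarticP t0); rewrite ?mul0r ?addr0 ?add0r ?expr1n ?mul1r //.
- by rewrite exprS i2 mulrN1.
- by rewrite exprS sqrrN expr1n mulr1.
by rewrite !mulN1r exprS sqrrN i2 mulrN1.
Qed.

Lemma qchi_pow4 (K : comPzRingType) (i : K) (t : 'F_p) : i ^+ 2 = -1 -> t != 0 ->
  qchi i t ^+ 4 = 1.
Proof.
by move=> i2 t0; rewrite exprS qchi_cube // qchi_conj.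
Qed.

Lemma qcharN1 : qchar (-1 : 'F_p) = 1.
Proof.
by rewrite -iota2 qchar_sqr // iota_neq0.
Qed.

Lemma qchar_mulchar (K : fieldType) :
  mulchar (fun t : 'F_p => (qchar t)%:~R : K).
Proof.
split=> [||s t]; [|by rewrite qchar1|by rewrite qcharM // rmorphM].
by rewrite /qchar eqxx.
Qed.

Lemma exists_qchar_nonresidue : exists2 t : 'F_p, t != 0 & qchar t = -1.
Proof.
have [g gP] := Fp_primitive_root pr.
have g0 : g != 0.
  apply/eqP => g0; move: (prim_expr_order gP); rewrite g0 expr0n.
  by have := prime_gt1 pr; case: (p) p1 => [|[|]] // n _ _ /eqP; rewrite eq_sym oner_eq0.
exists g => //; rewrite /qchar (negPf g0) -(prim_order_dvd gP).
by rewrite gtnNdvd //; have := prime_gt1 pr; lia.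
Qed.

Section Sums.

Variables (K : fieldType) (i : K).
Hypotheses (i2 : i ^+ 2 = -1) (two_neq0 : 2%:R != 0 :> K).

Lemma sum_qchi : \sum_t qchi i t = 0.
Proof.
have [t t0 tN] := exists_qchar_nonresidue.
apply: (sum_mulchar (qchi_mulchar i2) t0).
apply/eqP => e1; move: (qchi_sqr t i2); rewrite e1 tN expr1n => /eqP.
by rewrite -subr_eq0 rmorphN /= opprK (negPf two_neq0).
Qed.

Lemma sum_qcharK : \sum_(t : 'F_p) (qchar t)%:~R = 0 :> K.
Proof. by rewrite -rmorph_sum sum_qchar. Qed.

End Sums.

(** The real and imaginary parts of the Jacobi sum of the quartic character
    with itself. *)
Definition jre : int := \sum_t qre (t * (1 - t)).
Definition jim : int := \sum_t qim (t * (1 - t)).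

Lemma jacobi_qchi (K : fieldType) (i : K) : i ^+ 2 = -1 ->
  jacobi (qchi i) (qchi i) = jre%:~R + jim%:~R * i.
Proof.
move=> i2; rewrite /jacobi /jre /jim !rmorph_sum mulr_suml -big_split /=.
by apply: eq_bigr => t _; rewrite -qchiM.
Qed.

End QuarticCharacter.

(** * Biquadratic reciprocity for rational primes *)

(** A root of [1 + X + ... + X ^ (p - 1)] other than 1. *)
Lemma closed_field_primitive_root (K : closedFieldType) (p : nat) :
  prime p -> p%:R != 0 :> K -> exists z : K, p.-primitive_root z.
Proof.
move=> pr p0; have p1 := prime_gt1 pr.
have /closed_rootP[z]: size (\poly_(j < p) (1 : K)) != 1%N.
  by rewrite size_poly_eq ?oner_eq0 // neq_ltn p1 orbT.
rewrite /root horner_poly => /eqP sum0.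
have zp : z ^+ p = 1.
  apply/eqP; rewrite -subr_eq0 subrX1 [X in _ * X](_ : _ = 0) ?mulr0 //.
  by rewrite -[RHS]sum0; apply: eq_bigr => j _; rewrite mul1r.
have [m mz m_p] := prim_order_exists (prime_gt0 pr) zp.
exists z; have [m1|m1] := eqVneq m 1%N; last first.
  by move/(prime_nt_dvdP pr m1): m_p => <-.
case/eqP: p0; rewrite -sum0; have z1 := prim_expr_order mz.
rewrite m1 expr1 in z1; rewrite z1; under eq_bigr do rewrite expr1n mulr1.
by rewrite sumr_const card_ord.
Qed.

Section Reciprocity.

Variables (p : nat) (iota : 'F_p).
Hypotheses (pr : prime p) (p1 : (p %% 4 = 1)%N) (iota2 : iota ^+ 2 = -1).
Variables (K : fieldType) (i z : K).
Hypotheses (i2 : i ^+ 2 = -1) (two_neq0 : 2%:R != 0 :> K).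
Hypotheses (p_neq0 : p%:R != 0 :> K) (zP : p.-primitive_root z).

Let op := odd_mod4_1 p1.
Let i2' : (- i) ^+ 2 = -1. Proof. by rewrite sqrrN. Qed.
Let chi := qchi iota i.
Let chi' := qchi iota (- i).
Let rho (t : 'F_p) : K := (qchar t)%:~R.
Let J := (jre p)%:~R + (jim iota)%:~R * i.
Let J' := (jre p)%:~R - (jim iota)%:~R * i.

Let chiP : mulchar chi. Proof. exact: qchi_mulchar. Qed.
Let chi'P : mulchar chi'. Proof. exact: qchi_mulchar. Qed.
Let rhoP : mulchar rho. Proof. exact: qchar_mulchar. Qed.

Lemma gauss_qchar_sqr : gauss z rho ^+ 2 = p%:R.
Proof.
rewrite expr2 (gauss_conj pr zP rhoP rhoP).
- by rewrite /rho (qcharN1 pr p1 iota2) mul1r.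
- move=> t t0; rewrite /rho -intrM /qchar (negPf t0).
  by case: ifP; rewrite ?mulr1 // mulrNN mulr1.
exact: sum_qcharK.
Qed.

Lemma gauss_qchi_sqr : gauss z chi ^+ 2 = J * gauss z rho.
Proof.
rewrite expr2 (gaussM pr zP chiP chiP (omega := rho)) ?jacobi_qchi //.
- by move=> t; rewrite -expr2 qchi_sqr.
exact: sum_qcharK.
Qed.

Lemma gauss_qchi_conj_sqr : gauss z chi' ^+ 2 = J' * gauss z rho.
Proof.
rewrite expr2 (gaussM pr zP chi'P chi'P (omega := rho)) ?jacobi_qchi ?mulrN //.
- by move=> t; rewrite -expr2 qchi_sqr.
exact: sum_qcharK.
Qed.

Lemma gauss_qchi_pow4 : gauss z chi ^+ 4 = p%:R * J ^+ 2.
Proof. by rewrite (exprM _ 2 2) gauss_qchi_sqr exprMn gauss_qchar_sqr mulrC. Qed.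

Lemma gauss_qchi_conj : gauss z chi * gauss z chi' = chi (-1) * p%:R.
Proof.
rewrite (gauss_conj pr zP chiP chi'P) //; last exact: sum_qchi.
by move=> t t0; rewrite qchi_conj.
Qed.

(** Multiply the squares of the two conjugate Gauss sums, and cancel the square
    of the quadratic one. *)
Lemma jacobi_norm : J * J' = p%:R.
Proof.
apply: (mulIf p_neq0); rewrite -{1}gauss_qchar_sqr expr2 mulrACA.
rewrite -gauss_qchi_sqr -gauss_qchi_conj_sqr -exprMn gauss_qchi_conj exprMn.
by rewrite qchi_sqr // (qcharN1 pr p1 iota2) mul1r expr2.
Qed.

Lemma gauss_qchar_neq0 : gauss z rho != 0.
Proof. by rewrite -sqrf_eq0 gauss_qchar_sqr. Qed.

Lemma gauss_qchi_neq0 : gauss z chi != 0.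
Proof.
rewrite -sqrf_eq0 gauss_qchi_sqr mulf_neq0 ?gauss_qchar_neq0 //.
by apply: contraNneq p_neq0 => J0; rewrite -jacobi_norm J0 mul0r.
Qed.

Section Frobenius.

Variable q : nat.
Hypotheses (qP : q \in [pchar K]) (oq : odd q) (q_neq0 : q%:R != 0 :> 'F_p).

Lemma quadratic_reciprocity_in : rho q%:R * p%:R ^+ q.-1./2 = 1.
Proof.
have rhoq t : rho t = rho t ^+ q.
  rewrite /rho -rmorphXn /= /qchar; case: eqP => _.
    by rewrite expr0n; case: (q) oq.
  by case: ifP => _; rewrite ?expr1n // -signr_odd oq expr1.
apply: (mulIf gauss_qchar_neq0).
rewrite mul1r -[RHS](gauss_frobenius pr zP qP q_neq0 rhoP rhoq) -mulrA.
congr (_ * _); rewrite -gauss_qchar_sqr -exprM -exprSr.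
by congr (_ ^+ _); lia.
Qed.

(** With the fourth power of the Gauss sum known, its [q]-th power expresses
    the quartic character of [q] modulo [p] through [p] and [J] modulo [q]: the
    Frobenius map fixes the quartic character when [q] is 1 modulo 4, and
    conjugates it when [q] is 3 modulo 4. *)
Lemma quartic_reciprocity1 : (q %% 4 = 1)%N ->
  chi q%:R * (p%:R * J ^+ 2) ^+ (q %/ 4) = 1.
Proof.
move=> q1; have chiq t : chi t = chi t ^+ q.
  have [->|t0] := eqVneq t 0.
    by have [-> _ _] := chiP; rewrite expr0n; case: (q) oq.
  by rewrite (divn_eq q 4) q1 addn1 exprS mulnC exprM qchi_pow4 // expr1n mulr1.
apply: (mulIf gauss_qchi_neq0).
rewrite mul1r -[RHS](gauss_frobenius pr zP qP q_neq0 chiP chiq) -mulrA.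
congr (_ * _); rewrite -gauss_qchi_pow4 -exprM -exprSr.
by congr (_ ^+ _); lia.
Qed.

Lemma quartic_reciprocity3 : (q %% 4 = 3)%N ->
  chi' q%:R * (p%:R * J ^+ 2) ^+ (q.+1 %/ 4) = chi (-1) * p%:R.
Proof.
move=> q3; have chiq t : chi' t = chi t ^+ q.
  have [->|t0] := eqVneq t 0.
    have [-> _ _] := chiP; have [-> _ _] := chi'P.
    by rewrite expr0n; case: (q) oq.
  rewrite (divn_eq q 4) q3 exprD mulnC exprM qchi_pow4 // expr1n mul1r.
  by rewrite qchi_cube.
rewrite -gauss_qchi_conj -(gauss_frobenius pr zP qP q_neq0 chi'P chiq) [RHS]mulrCA.
congr (_ * _); rewrite -gauss_qchi_pow4 -exprM -exprS.
by congr (_ ^+ _); lia.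
Qed.

End Frobenius.

End Reciprocity.

(** * The Jacobi sum of the quartic character *)

Lemma sum_involution_mod2 (T : finType) (s : T -> T) (h : T -> int) :
    involutive s -> (forall t, h (s t) = h t) ->
  (\sum_t h t = \sum_(t | s t == t) h t %[mod 2])%Z.
Proof.
move=> sK hs; pose r := @enum_rank T.
rewrite (bigID (fun t => s t == t)) /=.
rewrite [\sum_(i | s i != i) _](bigID (fun t => r t < r (s t))%N) /=.
set u := \sum_(i | _ && (_ < _)%N) _; set v := \sum_(i | _ && ~~ _) _.
suff -> : v = u by rewrite addrC -mulr2n -[u *+ 2]mulr_natr modzMDl.
rewrite /v /u (reindex_inj (inv_inj sK)) /=; apply: eq_big => [t|t _]; last exact: hs.
rewrite sK [t == s t]eq_sym; case: eqVneq => //= st.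
by rewrite -leqNgt leq_eqVlt val_eqE (inj_eq enum_rank_inj) eq_sym (negPf st).
Qed.

Lemma four_eq_minus_pow4 (K : comPzRingType) (i : K) :
  i ^+ 2 = -1 -> 4 = - (1 + i) ^+ 4.
Proof.
move=> i2; suff -> : (1 + i) ^+ 4 = (i ^+ 2) ^+ 2 + 6 * i ^+ 2 + 1 + 4 * i * (1 + i ^+ 2).
  by rewrite i2; ring.
by ring.
Qed.

(** For the Gaussian integers [z = A + i B] and [w = x + i b] of norm [P], the
    real part [k P] of [z * conj w], whose norm is [P ^ 2], can only be [P],
    [- P] or 0. In the first two cases [z] is [w] or [- w]; parity excludes the
    third. *)
Lemma associated_of_norm (P A B x b k : int) :
    0 < P -> A ^+ 2 + B ^+ 2 = P -> x ^+ 2 + b ^+ 2 = P ->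
    A * x + B * b = k * P -> ~~ (2 %| A)%Z -> (2 %| B)%Z -> ~~ (2 %| x)%Z ->
  exists e : bool, A = (-1) ^+ e * x /\ B = (-1) ^+ e * b.
Proof.
move=> P_gt0 norm pE kE oddA evB oddx.
have k_neq0 : k != 0.
  apply/eqP => k0; move: kE; rewrite k0 mul0r {norm pE P_gt0}.
  have /dvdzP[b' ->] := evB.
  have [a' ->] : exists a', A = 2 * a' + 1 by exists (A %/ 2)%Z; lia.
  have [x' ->] : exists x', x = 2 * x' + 1 by exists (x %/ 2)%Z; lia.
  have -> : (2 * a' + 1) * (2 * x' + 1) + b' * 2 * b =
    2 * (2 * a' * x' + a' + x' + b' * b) + 1 by ring.
  by move: (2 * a' * x' + _ + _ + _) => m; lia.
have brahma : (A * x + B * b) ^+ 2 + (A * b - B * x) ^+ 2 = P ^+ 2.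
  by rewrite [RHS]expr2 -{1}norm -pE; ring.
have k2 : k ^+ 2 <= 1.
  rewrite -(ler_pM2r (exprn_gt0 2 P_gt0)) mul1r -exprMn -kE -brahma.
  by rewrite lerDl sqr_ge0.
have k1 : k = 1 \/ k = -1 by move: k_neq0 k2; clear; nia.
have d0 : A * b = B * x.
  apply/eqP; rewrite -subr_eq0 -sqrf_eq0; apply/eqP.
  have k21 : k ^+ 2 = 1 by case: k1 => ->.
  by move: brahma; rewrite kE exprMn k21 mul1r -[RHS]addr0 => /addrI.
have AE : A = k * x.
  apply: (mulIf (lt0r_neq0 P_gt0)); rewrite mulrAC -kE -pE.
  transitivity (A * x * x + A * b * b); first by ring.
  by rewrite d0; ring.
have BE : B = k * b.
  apply: (mulIf (lt0r_neq0 P_gt0)); rewrite mulrAC -kE -pE.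
  transitivity (B * x * x + B * b * b); first by ring.
  by rewrite -d0; ring.
by case: k1 AE BE => ->; [exists false|exists true].
Qed.

Section JacobiSum.

Variables (p : nat) (iota : 'F_p).
Hypotheses (pr : prime p) (p1 : (p %% 4 = 1)%N) (iota2 : iota ^+ 2 = -1).

Let op := odd_mod4_1 p1.

(** The norm computed in the algebraic numbers. *)
Lemma jacobi_norm_int : jre p ^+ 2 + jim iota ^+ 2 = p%:Z.
Proof.
have p0 : p%:R != 0 :> algC by rewrite pnatr_eq0 -lt0n prime_gt0.
have [z zP] := closed_field_primitive_root pr p0.
have two0 : 2%:R != 0 :> algC by rewrite pnatr_eq0.
have := jacobi_norm pr p1 iota2 (sqrCi _) two0 p0 zP.
move: (jre p) (jim iota) => a b; rewrite mulrC -subr_sqr exprMn sqrCi mulrN1 opprK.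
by move=> /eqP; rewrite -!rmorphXn -rmorphD /= -[p%:R]/(p%:Z%:~R) eqr_int => /eqP.
Qed.

Lemma sum_power_eq0 (k : nat) : (0 < k < p.-1)%N -> \sum_(t : 'F_p) t ^+ k = 0.
Proof.
move=> /andP[k0 kp]; have [g gP] := Fp_primitive_root pr.
have p2 := prime_gt1 pr.
apply: (@sum_mulchar _ _ (fun t : 'F_p => t ^+ k) g).
- split; rewrite ?expr1n //; last exact: exprMn.
  by rewrite expr0n eqn0Ngt k0.
- apply/eqP => g0; move: (prim_expr_order gP); rewrite g0 expr0n.
  rewrite (_ : (p.-1 == 0)%N = false); last by lia.
  by move/eqP; rewrite eq_sym oner_eq0.
by rewrite -(prim_order_dvd gP) gtnNdvd.
Qed.

(** In [F_p] itself, with [i = iota], the character is a power map and the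
    Jacobi sum becomes a combination of vanishing power sums. *)
Lemma jacobi_mod_p : (jre p)%:~R + (jim iota)%:~R * iota = 0 :> 'F_p.
Proof.
have h0 := prime1_quarter_gt0 pr p1.
rewrite -(jacobi_qchi pr p1 iota2 iota2).
transitivity (\sum_(t : 'F_p) (t * (1 - t)) ^+ (p %/ 4)).
  apply: eq_bigr => t _; rewrite -qchiM //; move: (t * _) => u.
  have [->|u0] := eqVneq u 0.
    by rewrite /qchi qre0 // (qim0 pr p1 iota2) quarter_power0 // mul0r addr0.
  by rewrite /qchi; case: (quarticP pr p1 iota2 u0);
    rewrite ?mul0r ?addr0 ?add0r ?mul1r ?mulN1r.
under eq_bigr do rewrite exprMn exprBn mulr_sumr.
rewrite exchange_big big1 //= => j _.
transitivity (\sum_(t : 'F_p) ((-1) ^+ j *+ 'C(p %/ 4, j)) * t ^+ (p %/ 4 + j)).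
  by apply: eq_bigr => t _; rewrite expr1n mulr1 exprD mulrnAr mulrnAl mulrCA.
rewrite -mulr_sumr sum_power_eq0 ?mulr0 //.
by have := ltn_ord j; lia.
Qed.


Lemma quartic_minus_pow4 (u : 'F_p) : u != 0 ->
  qre (- u ^+ 4) = (-1) ^+ (p %/ 4) /\ qim iota (- u ^+ 4) = 0.
Proof.
move=> u0; have e1 : (- u ^+ 4) ^+ (p %/ 4) = (-1) ^+ (p %/ 4).
  by rewrite -[- u ^+ 4]mulN1r exprMn -[(u ^+ 4) ^+ _]exprM (_ : (4 * _ = p.-1)%N) ?fermat ?mulr1 //; lia.
by rewrite /qre /qim e1 -![_ ^+ (p %/ 4)]signr_odd; case: (odd _);
  rewrite ?expr1 ?eqxx ?(fourth_roots_distinct pr p1 iota2).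
Qed.

(** As [4 t ^ 2 = 1] at the fixed point [t] of [t |-> 1 - t], the value
    [t * (1 - t) = t ^ 2] is minus a fourth power. *)
Lemma half_fixed (t : 'F_p) : 1 - t = t -> t != 0 /\ t * (1 - t) = - ((1 + iota) * t) ^+ 4.
Proof.
move=> tt; have t2 : 2 * t = 1 by rewrite mulr_natl mulr2n -{1}tt subrK.
have t0 : t != 0 by apply: contra_eqN t2 => /eqP ->; rewrite mulr0 eq_sym oner_eq0.
split=> //; rewrite tt exprMn -mulNr -(four_eq_minus_pow4 iota2).
have t4 : 4 * t ^+ 2 = 1 by rewrite -[4]/((2 ^ 2)%:R) natrX -exprMn t2 expr1n.
by rewrite (exprD t 2 2) mulrA t4 mul1r expr2.
Qed.

Lemma one_plus_iota_neq0 : 1 + iota != 0.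
Proof.
apply/eqP => e0; have := four_eq_minus_pow4 iota2; rewrite e0 expr0n oppr0.
by move/eqP; rewrite -[4]/((2 * 2)%:R) natrM mulf_eq0 (negPf (prime_two_neq0 pr op)).
Qed.

Lemma quartic_half (t : 'F_p) : 1 - t = t ->
  [/\ t * (1 - t) != 0, qre (t * (1 - t)) = (-1) ^+ (p %/ 4)
    & qim iota (t * (1 - t)) = 0].
Proof.
move=> tt; have [t0 ->] := half_fixed tt.
have u0 : (1 + iota) * t != 0 by rewrite mulf_neq0 // one_plus_iota_neq0.
by have [-> ->] := quartic_minus_pow4 u0; rewrite oppr_eq0 expf_neq0.
Qed.

Let flip (t : 'F_p) := 1 - t.
Let flipK : involutive flip. Proof. by move=> t; rewrite /flip opprB addrC subrK. Qed.
Let flipM (t : 'F_p) : flip t * (1 - flip t) = t * (1 - t).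
Proof. by rewrite -/(flip (flip t)) flipK mulrC. Qed.

Lemma jim_even : (2 %| jim iota)%Z.
Proof.
have := sum_involution_mod2 flipK (h := fun t => qim iota (t * (1 - t))).
rewrite [\sum_(t | flip t == t) _]big1 => [|t ft]; last by have [_ _] := quartic_half (eqP ft).
by move=> /(_ _)/eqP; rewrite eqz_mod_dvd subr0; apply=> t; rewrite flipM.
Qed.

(** The involution [t |-> 1 - t] pairs equal terms of the Jacobi sum, and each
    pair contributes [1] or [-1] twice to [jre + jim]; only the fixed point
    [1/2] is left over. *)
Lemma jacobi_mod4 : (jre p + jim iota = (-1) ^+ (p %/ 4) + 2 %[mod 4])%Z.
Proof.
(* [H] is chosen so that each nonzero term [1] or [-1] of the sum is [1 + 2 H]. *)
pose H (u : 'F_p) : int :=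
  if u == 0 then 0 else if qre u + qim iota u == 1 then 0 else -1.
have HE u : qre u + qim iota u = (u != 0)%:R + 2 * H u.
  rewrite /H; have [->|u0] := eqVneq u 0; first by rewrite qre0 // (qim0 pr p1 iota2).
  by case: (quarticP pr p1 iota2 u0).
have two0 := prime_two_neq0 pr op.
have [t0 t0E] : exists t : 'F_p, 1 - t = t.
  exists 2^-1; apply: (mulfI two0); rewrite mulrBr mulr1 divff //.
  by rewrite -[2]/(1 + 1) addrK.
have fixE t : (flip t == t) = (t == t0).
  apply/eqP/eqP => [|-> //] tt; apply: (mulfI two0).
  by rewrite !mulr_natl !mulr2n -{1}t0E -{1}tt !subrK.
have [u0 re0 im0] := quartic_half t0E.
have H0 : (-1) ^+ (p %/ 4) = 1 + 2 * H (t0 * (1 - t0)).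
  by have := HE (t0 * (1 - t0)); rewrite re0 im0 u0 addr0.
have sumH : (\sum_t H (t * (1 - t)) = H (t0 * (1 - t0)) %[mod 2])%Z.
  have := sum_involution_mod2 flipK (h := fun t => H (t * (1 - t))).
  by rewrite [\sum_(t | flip t == t) _](big_pred1 t0) //; apply=> t; rewrite flipM.
(* The terms at [t = 0] and [t = 1] vanish. *)
have count : \sum_(t : 'F_p) (t * (1 - t) != 0)%:R = p%:Z - 2.
  transitivity (\sum_(t : 'F_p) (1 - (t == 0)%:R - (t == 1)%:R : int)).
    apply: eq_bigr => t _; rewrite mulf_eq0 subr_eq0 [1 == t]eq_sym.
    by case: (eqVneq t 0) => [->|_]; [rewrite eq_sym oner_eq0|case: (t == 1)].
  rewrite !sumrB sumr_const -[X in _ *+ X]/(#|'F_p|) card_Fp //.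
  rewrite (bigD1 (0 : 'F_p)) //= big1 => [|t /negPf -> //].
  by rewrite [\sum_(t : _) _](bigD1 (1 : 'F_p)) //= big1 => [|t /negPf -> //]; lia.
rewrite /jre /jim -big_split /=; under eq_bigr do rewrite HE.
rewrite big_split /= count -mulr_sumr H0.
move: sumH; move: (H _) (\sum_t _) => a b ab.
lia.
Qed.

Lemma jacobi_two_squares (x b : nat) :
    p = (x ^ 2 + b ^ 2)%N -> odd x -> iota * x%:R = b%:R ->
  exists e : bool, jre p = (-1) ^+ e * x%:Z /\ jim iota = (-1) ^+ e * b%:Z.
Proof.
move=> def_p ox ib; have evB := jim_even; have norm := jacobi_norm_int.
have pE : x%:Z ^+ 2 + b%:Z ^+ 2 = p%:Z by rewrite def_p PoszD !expr2 -!mulnn !PoszM.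
have /dvdzP[k kE] : (p%:Z %| jre p * x%:Z + jim iota * b%:Z)%Z.
  rewrite (dvdz_pcharf (pchar_Fp pr)) rmorphD !rmorphM /= -!pmulrn -ib.
  by rewrite mulrA -mulrDl jacobi_mod_p mul0r.
apply: (associated_of_norm _ norm pE kE _ evB).
- by have := prime_gt0 pr.
- apply/negP => evA; have /dvdzP[a' Ea] := evA; have /dvdzP[b' Eb] := evB.
  have : p%:Z = 2 * (2 * a' ^+ 2 + 2 * b' ^+ 2) by rewrite -norm Ea Eb; ring.
  by move: (_ + _) op => c; lia.
by move: ox; clear; lia.
Qed.

End JacobiSum.

(** * The trace of Frobenius of [y ^ 2 = x ^ 3 + D x] *)

Lemma frob_trace_sum (D : int) (p : nat) : prime p -> odd p ->
  frob_trace D p = - \sum_(x : 'F_p) qchar (x ^+ 3 + D%:~R * x).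
Proof.
move=> pr op; rewrite /frob_trace.
suff -> : #|E_points D p|%:Z = 1 + \sum_(x : 'F_p) (1 + qchar (x ^+ 3 + D%:~R * x)).
  rewrite big_split /= sumr_const -[X in _ *+ X]/(#|'F_p|) card_Fp // natz.
  by move: (\sum_x _) => s; ring.
pose S := [set P : 'F_p * 'F_p | P.2 ^+ 2 == P.1 ^+ 3 + D%:~R * P.1]%SET.
have -> : E_points D p = None |: [set Some P | P in S].
  apply/setP=> -[[x y]|]; rewrite !inE //=; apply/idP/imsetP.
    by exists (x, y); rewrite ?inE.
  by case=> -[x' y']; rewrite inE /= => e1 [-> ->].
rewrite cardsU1 (_ : None \notin _) ?card_imset; last 2 first.
- by move=> ? ? [].
- by apply/imsetP => -[].
rewrite PoszD; congr (_ + _); rewrite -sum1_card.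
rewrite (eq_bigl (fun P : 'F_p * 'F_p => true && (P.2 ^+ 2 == P.1 ^+ 3 + D%:~R * P.1))); last first.
  by move=> P; rewrite inE.
rewrite -(pair_big_dep xpredT (fun x y : 'F_p => y ^+ 2 == x ^+ 3 + D%:~R * x) (fun _ _ => 1%N)).
rewrite -natz natr_sum /=; apply: eq_bigr => x _.
rewrite -card_sqrt // natz sum1_card; congr Posz; apply: eq_card => y.
by rewrite !inE.
Qed.

Section FrobeniusTrace.

Variables (p : nat) (iota : 'F_p).
Hypotheses (pr : prime p) (p1 : (p %% 4 = 1)%N) (iota2 : iota ^+ 2 = -1).

Let op := odd_mod4_1 p1.

Section Twisted.

Variables (K : fieldType) (i : K).
Hypotheses (i2 : i ^+ 2 = -1) (two_neq0 : 2%:R != 0 :> K).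

Let chi := qchi iota i.
Let rho (t : 'F_p) : K := (qchar t)%:~R.

Let chiM : {morph chi : s t / s * t}. Proof. exact: qchiM. Qed.
Let rhoM : {morph rho : s t / s * t}.
Proof. by move=> s t; rewrite /rho qcharM // rmorphM. Qed.

(** Completing the square: [4 t (1 - t) = 1 - (2 t - 1) ^ 2]. *)
Lemma jacobi_chi_rho :
  chi 4 * jacobi chi chi = \sum_v chi v * rho (1 - v).
Proof.
have two0 := prime_two_neq0 pr op.
transitivity (\sum_(s : 'F_p) chi (1 - s ^+ 2)).
  have inj : injective (fun t : 'F_p => 2 * t - 1) by move=> s t /addIr /(mulfI two0).
  rewrite (reindex_inj inj) /jacobi mulr_sumr; apply: eq_bigr => t _.
  by rewrite -!chiM; congr (chi _); ring.
rewrite (sum_over_squares (fun c => chi (1 - c))) //.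
under eq_bigr do rewrite rmorphD mulrDr mulr1.
rewrite big_split /= (reindex_inj (inv_inj (_ : involutive (fun t : 'F_p => 1 - t)))) /=; last first.
  by move=> t; rewrite opprB addrC subrK.
under eq_bigr do rewrite opprB addrC subrK.
rewrite (sum_qchi pr p1 iota2 i2 two_neq0) add0r.
rewrite (reindex_inj (inv_inj (_ : involutive (fun t : 'F_p => 1 - t)))) /=; last first.
  by move=> t; rewrite opprB addrC subrK.
by apply: eq_bigr => t _; rewrite opprB addrC subrK.
Qed.

(** Substituting [c = - D v] pulls out [D]; the constant [chi (-4)] that remains
    is 1. *)
Lemma sum_chi_rho_shift (D : 'F_p) : D != 0 ->
  \sum_c chi c * rho (c + D) = qchi iota (- i) D * jacobi chi chi.
Proof.
move=> D0; have nD0 : - D != 0 by rewrite oppr_eq0.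
rewrite (reindex_inj (mulfI nD0)) /=.
transitivity (chi (- D) * rho D * (chi 4 * jacobi chi chi)).
  rewrite jacobi_chi_rho mulr_sumr; apply: eq_bigr => v _.
  rewrite (_ : - D * v + D = D * (1 - v)); last by rewrite mulrBr mulr1 mulNr addrC.
  by rewrite chiM rhoM; ring.
rewrite mulrA; congr (_ * _).
rewrite -qchi_cube // -/chi -mulN1r chiM /rho -(qchi_sqr pr p1 iota2 _ i2) -/chi.
have e1 : chi (-1) * chi 4 = 1.
  rewrite -chiM mulN1r (four_eq_minus_pow4 iota2) opprK.
  have -> : (1 + iota) ^+ 4 = (1 + iota) * (1 + iota) * (1 + iota) * (1 + iota).
    by rewrite !exprS expr0 mulr1 !mulrA.
  rewrite !chiM -[RHS](qchi_pow4 pr p1 iota2 i2 (one_plus_iota_neq0 pr p1 iota2)) -/chi.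
  by rewrite !exprS expr0 mulr1 !mulrA.
by transitivity (chi (-1) * chi 4 * chi D ^+ 3); [ring | rewrite e1 mul1r].
Qed.

End Twisted.

(** Writing the quadratic character of [x] as the quartic character of [x ^ 2]
    makes the sum over points one over squares, hence a combination of the two
    conjugate Jacobi sums twisted by the quartic character of [D]. *)
Lemma sum_qchar_cubic_in (K : fieldType) (i : K) (d : 'F_p) :
    i ^+ 2 = -1 -> 2%:R != 0 :> K -> d != 0 ->
  (\sum_(x : 'F_p) qchar (x ^+ 3 + d * x))%:~R =
  (2 * (qre d * jre p + qim iota d * jim iota))%:~R :> K.
Proof.
move=> i2 two0 d0; have i2' : (- i) ^+ 2 = -1 by rewrite sqrrN.
rewrite rmorph_sum /=.
transitivity (\sum_(x : 'F_p) qchi iota i (x ^+ 2) * (qchar (x ^+ 2 + d))%:~R).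
  apply: eq_bigr => x _; rewrite expr2 qchiM // -expr2 qchi_sqr // -intrM -qcharM //.
  by congr ((qchar _)%:~R); ring.
rewrite (sum_over_squares (fun c => qchi iota i c * (qchar (c + d))%:~R)) //.
transitivity (\sum_c qchi iota i c * (qchar (c + d))%:~R +
              \sum_c qchi iota (- i) c * (qchar (c + d))%:~R : K).
  rewrite -big_split /=; apply: eq_bigr => c _; rewrite rmorphD /= mulrDr mulr1.
  by congr (_ + _); rewrite -(qchi_cube pr p1 iota2 c i2) exprSr qchi_sqr //; ring.
rewrite !sum_chi_rho_shift // opprK !jacobi_qchi // /qchi.
move: (qre d) (qim iota d) (jre p) (jim iota) => r m a b.
rewrite intrM [(r * a + _)%:~R]intrD !intrM !mulrN -!mulNr !gaussian_mul //; ring.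
Qed.

Lemma frob_trace_jacobi (D : int) : D%:~R != 0 :> 'F_p ->
  frob_trace D p = - (2 * (qre (D%:~R : 'F_p) * jre p + qim iota D%:~R * jim iota)).
Proof.
move=> D0; rewrite frob_trace_sum //; congr (- _); apply: (@intr_inj algC).
apply: (sum_qchar_cubic_in (sqrCi _)) => //; by rewrite pnatr_eq0.
Qed.

End FrobeniusTrace.

(** * Primes of the form [x ^ 2 + b ^ 2] with [b] fixed *)

(** A field of characteristic [q] large enough for every Gauss sum needed. *)
Lemma algebraic_closure_Fp (q : nat) : prime q -> odd q ->
  exists K : closedFieldType, exists2 i : K, i ^+ 2 = -1 & q \in [pchar K].
Proof.
move=> pr oq; have [K [f _]] := countable_algebraic_closure 'F_q.
exists K; have /closed_rootP[i] : size ('X^2 + 1 : {poly K}) != 1%N.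
  by rewrite size_polyDl ?size_polyXn ?size_poly1.
rewrite /root !hornerE => /eqP i0; exists i; last by rewrite (rmorph_pchar f) // pchar_Fp.
by apply/eqP; rewrite -addr_eq0 i0.
Qed.

Section TwoSquares.

Variables (b x p : nat).
Hypotheses (b_gt0 : (0 < b)%N) (even_b : ~~ odd b).
Hypotheses (pr : prime p) (def_p : p = (x ^ 2 + b ^ 2)%N).

Lemma two_squares_odd : odd x.
Proof.
have : odd p.
  case/even_prime: pr => // p2; move: def_p; rewrite p2.
  by case: b b_gt0 even_b => [|[|n]] // _ _; rewrite -!mulnn; nia.
by rewrite def_p oddD !oddX (negPf even_b) /= addbF.
Qed.

Lemma two_squares_mod8 : (p = 1 + 4 * odd b./2 %[mod 8])%N.
Proof.
have [x' Ex] : exists x', x = (2 * x' + 1)%N.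
  by exists x./2; have := two_squares_odd; clear; lia.
have [y Ey] : exists y, b = (2 * y)%N by exists b./2; move: even_b; clear; lia.
have -> : b./2 = y by rewrite Ey; clear; lia.
have [m Em] : exists m, (x' * (x' + 1) = 2 * m)%N.
  exists (x' * (x' + 1))./2.
  have : ~~ odd (x' * (x' + 1)) by rewrite oddM oddD addbT; case: (odd x').
  by clear; lia.
have [k Ek] : exists k, (y * y = 2 * k + odd y)%N.
  by exists (y * y)./2; rewrite -{1}(odd_double_half (y * y)) oddM andbb -mul2n addnC.
have -> : p = (1 + 4 * odd y + 8 * (m + k))%N.
  rewrite def_p Ex Ey; have -> : ((2 * x' + 1) ^ 2 + (2 * y) ^ 2 =
    1 + 4 * (x' * (x' + 1)) + 4 * (y * y))%N by ring.
  by rewrite Em Ek; ring.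
by rewrite addnC [(8 * _)%N]mulnC modnMDl.
Qed.

Lemma two_squares_mod4 : (p %% 4 = 1)%N.
Proof. by have := two_squares_mod8; clear; case: (odd _); lia. Qed.

Lemma two_squares_odd_quarter : odd (p %/ 4) = odd b./2.
Proof. by have := two_squares_mod8; clear; case: (odd _); lia. Qed.

Lemma two_squares_neq0 : x%:R != 0 :> 'F_p.
Proof.
have x_odd := two_squares_odd.
rewrite -(dvdn_pcharf (pchar_Fp pr)) gtnNdvd ?odd_gt0 // def_p -!mulnn.
by move: b_gt0; clear; nia.
Qed.

(** The square root of -1 modulo [p] at which [x + i b] vanishes. *)
Definition two_squares_iota : 'F_p := b%:R / x%:R.

Lemma two_squares_iotaE : two_squares_iota * x%:R = b%:R.
Proof. by rewrite /two_squares_iota mulfVK // two_squares_neq0. Qed.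

Lemma two_squares_iota_sqr : two_squares_iota ^+ 2 = -1.
Proof.
apply: (mulIf (expf_neq0 2 two_squares_neq0)).
rewrite -exprMn two_squares_iotaE mulN1r; apply/eqP; rewrite -addr_eq0 addrC.
by rewrite -!natrX -natrD -def_p pchar_Fp_0.
Qed.

End TwoSquares.

(** The congruence pins the sign [e] down because [x + b] is odd. *)
Lemma two_squares_jacobi (b x p : nat) :
    (0 < b)%N -> ~~ odd b -> prime p -> p = (x ^ 2 + b ^ 2)%N ->
  exists e : bool,
    [/\ jre p = (-1) ^+ e * x%:Z, jim (two_squares_iota b x p) = (-1) ^+ e * b%:Z &
        ((-1) ^+ e * (x + b)%:Z = (-1) ^+ odd b./2 + 2 %[mod 4])%Z].
Proof.
move=> b0 eb pr def_p; have p1 := two_squares_mod4 b0 eb pr def_p.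
have i2 := two_squares_iota_sqr b0 eb pr def_p.
have ox := two_squares_odd b0 eb pr def_p.
have [e [re im]] := jacobi_two_squares pr p1 i2 def_p ox (two_squares_iotaE b0 eb pr def_p).
exists e; split=> //; have := jacobi_mod4 pr p1 i2.
rewrite re im -(signr_odd _ (p %/ 4)) (two_squares_odd_quarter b0 eb pr def_p) => <-.
by rewrite PoszD mulrDr.
Qed.

(** The difference of two distinct fourth roots of unity has norm 2 or 4. *)
Lemma coord_inj (K : fieldType) (i : K) (r m r' m' : int) :
    i ^+ 2 = -1 -> 2%:R != 0 :> K -> r ^+ 2 + m ^+ 2 = 1 -> r' ^+ 2 + m' ^+ 2 = 1 ->
    r%:~R + m%:~R * i = r'%:~R + m'%:~R * i ->
  r = r' /\ m = m'.
Proof.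
move=> i2 two0 rm rm' eqK; pose t := r * r' + m * m'.
have dist : (r - r') ^+ 2 + (m - m') ^+ 2 = 2 * (1 - t).
  transitivity ((r ^+ 2 + m ^+ 2) + (r' ^+ 2 + m' ^+ 2) - 2 * t); last by rewrite rm rm'; ring.
  by rewrite /t; ring.
have t2 : t ^+ 2 <= 1.
  have <- : t ^+ 2 + (r * m' - m * r') ^+ 2 = 1.
    transitivity ((r ^+ 2 + m ^+ 2) * (r' ^+ 2 + m' ^+ 2)); last by rewrite rm rm'.
    by rewrite /t; ring.
  by rewrite lerDl sqr_ge0.
have distK : (2 * (1 - t))%:~R = 0 :> K.
  rewrite -dist rmorphD !rmorphXn !rmorphB /=.
  have -> : m%:~R - m'%:~R = (r%:~R - r'%:~R) * i.
    have -> : r%:~R - r'%:~R = (m'%:~R - m%:~R) * i.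
      by apply/eqP; rewrite subr_eq -(inj_eq (addIr (m%:~R * i))) eqK; apply/eqP; ring.
    by rewrite -mulrA -expr2 i2 mulrN1 opprB.
  by rewrite exprMn i2 mulrN1 subrr.
have t1 : t = 1.
  have : t = 1 \/ (t = 0 \/ t = -1) by move: t2; clear; move: t => k; nia.
  case=> [//|[] tE]; move: distK; rewrite tE.
    by move/eqP; rewrite subr0 mulr1 (negPf two0).
  by move/eqP; rewrite opprK intrM mulf_eq0 (negPf two0).
move: dist; rewrite t1 subrr mulr0 => /eqP.
rewrite paddr_eq0 ?sqr_ge0 // !sqrf_eq0 !subr_eq0.
by case/andP => /eqP -> /eqP ->.
Qed.

Lemma natr_pow_char (K : fieldType) (q n : nat) : q \in [pchar K] ->
  (n%:R : K) ^+ q = n%:R.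
Proof. by move=> qP; rewrite -(pFrobenius_autE qP) rmorph_nat. Qed.

Lemma eq_int_char (K : fieldType) (q : nat) (a c : int) :
    prime q -> q \in [pchar K] ->
  a%:~R = c%:~R :> 'F_q -> a%:~R = c%:~R :> K.
Proof.
move=> qpr qK /eqP; rewrite -subr_eq0 -rmorphB -(dvdz_pcharf (pchar_Fp qpr)).
by rewrite (dvdz_pcharf qK) rmorphB subr_eq0 => /eqP.
Qed.

(** Changing [x] into [- x] modulo [q] replaces [x + i b] by minus its
    conjugate, and so the quartic character of [q] by its conjugate. *)
Lemma quartic_char_pair (b x x' p p' q : nat) (s : bool) :
    (0 < b)%N -> ~~ odd b ->
    prime p -> p = (x ^ 2 + b ^ 2)%N -> prime p' -> p' = (x' ^ 2 + b ^ 2)%N ->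
    prime q -> odd q -> q != p -> q != p' ->
    x'%:R = (-1) ^+ s * x%:R :> 'F_q ->
  qre (q%:R : 'F_p') = qre (q%:R : 'F_p) /\
  qim (two_squares_iota b x' p') q%:R = (-1) ^+ s * qim (two_squares_iota b x p) q%:R.
Proof.
move=> b0 eb pr def_p pr' def_p' qpr oq qp qp' xx'.
have [K [i i2 qK]] := algebraic_closure_Fp qpr oq.
have p1 := two_squares_mod4 b0 eb pr def_p; have p1' := two_squares_mod4 b0 eb pr' def_p'.
set I := two_squares_iota b x p; set I' := two_squares_iota b x' p'.
have I2 : I ^+ 2 = -1 := two_squares_iota_sqr b0 eb pr def_p.
have I2' : I' ^+ 2 = -1 := two_squares_iota_sqr b0 eb pr' def_p'.
have neq0K n : prime n -> q != n -> n%:R != 0 :> K.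
  by move=> npr qn; rewrite -(dvdn_pcharf qK) dvdn_prime2.
have two0 : 2%:R != 0 :> K by apply: neq0K => //; apply: contraTneq oq => ->.
have pK := neq0K _ pr qp; have pK' := neq0K _ pr' qp'.
have q0 : q%:R != 0 :> 'F_p by rewrite -(dvdn_pcharf (pchar_Fp pr)) dvdn_prime2 // eq_sym.
have q0' : q%:R != 0 :> 'F_p' by rewrite -(dvdn_pcharf (pchar_Fp pr')) dvdn_prime2 // eq_sym.
have [z zP] := closed_field_primitive_root pr pK.
have [z' zP'] := closed_field_primitive_root pr' pK'.
have xK : x'%:R = (-1) ^+ s * x%:R :> K.
  have := eq_int_char (a := x'%:Z) (c := (-1) ^+ s * x%:Z) qpr qK.
  by rewrite !rmorphM !rmorph_sign /= -!pmulrn; apply.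
pose P : K := p%:R; pose X : K := x%:R; pose B : K := b%:R.
have PE : P = X ^+ 2 + B ^+ 2 by rewrite /P def_p natrD !natrX.
have PE' : p'%:R = P by rewrite PE def_p' natrD !natrX xK exprMn sqrr_sign mul1r.
have [e [re im _]] := two_squares_jacobi b0 eb pr def_p.
have [e' [re' im' _]] := two_squares_jacobi b0 eb pr' def_p'.
have JE : ((jre p)%:~R + (jim I)%:~R * i) ^+ 2 = (X + B * i) ^+ 2 :> K.
  rewrite re im !rmorphM rmorph_sign /= -!pmulrn -mulrA -mulrDr exprMn.
  by rewrite sqrr_sign mul1r.
have JE' : ((jre p')%:~R + (jim I')%:~R * i) ^+ 2 = (X + (-1) ^+ s * B * i) ^+ 2 :> K.
  rewrite re' im' !rmorphM rmorph_sign /= -!pmulrn -mulrA -mulrDr exprMn.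
  by rewrite sqrr_sign mul1r xK -/X -/B; case: (s); rewrite ?expr0 ?expr1; ring.
have normK : (X + B * i) * (X - B * i) = P.
  by rewrite mulrC -subr_sqr exprMn i2 mulrN1 opprK PE.
have P0 : P != 0 := pK.
have J0 : (X + B * i) != 0.
  by apply: contraNneq P0 => J0; rewrite -normK J0 mul0r.
have fixP : P ^+ q.-1 = 1.
  apply: (mulfI P0); rewrite -exprS prednK ?prime_gt0 // mulr1.
  exact: natr_pow_char.
have chiN1 : qchi I i (-1) = qchi I' i (-1) :> K.
  have e1 (n : nat) (J : 'F_n) : prime n -> (n %% 4 = 1)%N -> J ^+ 2 = -1 ->
      qchi J i (-1) = (-1) ^+ odd (n %/ 4) :> K.
    move=> npr n1 J2; have [] := quartic_minus_pow4 npr n1 J2 (oner_neq0 _).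
    by rewrite /qchi expr1n => -> ->; rewrite mul0r addr0 rmorphXn /= signr_odd.
  by rewrite !e1 // (two_squares_odd_quarter b0 eb pr def_p)
    (two_squares_odd_quarter b0 eb pr' def_p').
have chiN1_sqr : qchi I i (-1) ^+ 2 = 1 by rewrite (qchi_sqr pr p1 I2) // (qcharN1 pr p1 I2).
(* According to [q] modulo 4, reciprocity gives the character with [i] or its
   conjugate; [j] stands for the relevant root of -1. *)
have main (j : K) : j ^+ 2 = -1 -> (q %% 4 = 1 -> j = i)%N -> (q %% 4 = 3 -> j = - i)%N ->
    qchi I' j q%:R = if s then qchi I (- j) q%:R else qchi I j q%:R.
  move=> j2 j1 j3; set c := qchi I j q%:R; set c' := qchi I' j q%:R.
  pose Y := P * (X + B * i) ^+ 2; pose Y' := P * (X + (-1) ^+ s * B * i) ^+ 2.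
  have Y0 : Y != 0 by rewrite mulf_neq0 // expf_neq0.
  have YY' : s -> Y * Y' = P ^+ 4.
    rewrite /Y' => ->; rewrite expr1 !mulN1r !mulNr.
    transitivity ((P * ((X + B * i) * (X - B * i))) ^+ 2); last by rewrite normK; ring.
    by rewrite /Y; ring.
  (* The exponent [n] is [(q - 1) / 4] or [(q + 1) / 4]; both reciprocity laws
     say that [c * Y ^ n] is a quantity [w] common to [p] and [p']. *)
  have [n [w [w2 cY cY']]] : exists n, exists w,
      [/\ w ^+ 2 = P ^+ 4 ^+ n, c * Y ^+ n = w & c' * Y' ^+ n = w].
    have q4 : (q %% 4 = 1)%N \/ (q %% 4 = 3)%N by move: oq; clear; lia.
    case: q4 => qmod.
      have qr := quartic_reciprocity1 pr p1 I2 i2 two0 pK zP qK oq q0 qmod.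
      have qr' := quartic_reciprocity1 pr' p1' I2' i2 two0 pK' zP' qK oq q0' qmod.
      exists (q %/ 4)%N, 1; rewrite /c /c' (j1 qmod); split=> //.
      - rewrite expr1n -exprM (_ : (4 * (q %/ 4) = q.-1)%N) ?fixP //.
        by move: qmod; clear; lia.
      - by rewrite /Y -JE.
      by rewrite /Y' -JE' -PE'.
    have qr := quartic_reciprocity3 pr p1 I2 i2 two0 pK zP qK oq q0 qmod.
    have qr' := quartic_reciprocity3 pr' p1' I2' i2 two0 pK' zP' qK oq q0' qmod.
    exists (q.+1 %/ 4)%N, (qchi I i (-1) * P); rewrite /c /c' (j3 qmod); split=> //.
    - rewrite exprMn chiN1_sqr mul1r -exprM (_ : (4 * (q.+1 %/ 4) = q.-1 + 2)%N).
        by rewrite exprD fixP mul1r.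
      by move: qmod; clear; lia.
    - by rewrite /Y -JE.
    by rewrite /Y' -JE' chiN1 -PE'.
  case: (s) @Y' YY' cY' => Y' YY' cY'.
    have cc : c * c' = 1.
      apply: (mulIf (_ : (Y * Y') ^+ n != 0)).
        by rewrite YY' // expf_neq0 // expf_neq0.
      by rewrite mul1r {2}YY' // -w2 expr2 -{1}cY -cY' exprMn; ring.
    have c0 : c != 0 by apply: contra_eq_neq cc => ->; rewrite mul0r eq_sym oner_eq0.
    by apply: (mulfI c0); rewrite cc /c (qchi_conj pr p1 I2 j2 q0).
  apply: (mulIf (expf_neq0 n Y0)); rewrite cY -cY' /Y' expr0 mul1r.
  by [].
have concl (j : K) (t : 'F_p) (t' : 'F_p') : j ^+ 2 = -1 -> t != 0 -> t' != 0 ->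
    qchi I' j t' = (if s then qchi I (- j) t else qchi I j t) ->
    qre t' = qre t /\ qim I' t' = (-1) ^+ s * qim I t.
  move=> j2 t0 t0' e1; apply: (coord_inj j2 two0).
  - exact: (qnorm1 pr' p1' I2' t0').
  - by rewrite exprMn sqrr_sign mul1r (qnorm1 pr p1 I2 t0).
  rewrite -/(qchi I' j t') e1; case: (s); rewrite /qchi.
    by rewrite expr1 mulN1r rmorphN /= mulrN mulNr.
  by rewrite expr0 mul1r.
have [qmod|qmod] : (q %% 4 = 1)%N \/ (q %% 4 = 3)%N by move: oq; clear; lia.
  by apply: (concl i) => //; apply: main => //; rewrite qmod.
by apply: (concl (- i)); rewrite ?sqrrN //; apply: main; rewrite ?sqrrN ?qmod.
Qed.

(** The square of the quadratic Gauss sum is [p] itself, as [p] is 1 modulo 4. *)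
Lemma quadratic_reciprocity_mod4 (p q : nat) :
    prime p -> (p %% 4 = 1)%N -> prime q -> odd q -> q != p ->
  qchar (q%:R : 'F_p) = qchar (p%:R : 'F_q).
Proof.
move=> pr p1 qpr oq qp; have op := odd_mod4_1 p1.
have [K [i i2 qK]] := algebraic_closure_Fp qpr oq.
have neq0K n : prime n -> q != n -> n%:R != 0 :> K.
  by move=> npr qn; rewrite -(dvdn_pcharf qK) dvdn_prime2.
have two0 : 2%:R != 0 :> K by apply: neq0K => //; apply: contraTneq oq => ->.
have pK := neq0K _ pr qp.
have [z zP] := closed_field_primitive_root pr pK.
have q0 : q%:R != 0 :> 'F_p by rewrite -(dvdn_pcharf (pchar_Fp pr)) dvdn_prime2 // eq_sym.
have p0 : p%:R != 0 :> 'F_q by rewrite -(dvdn_pcharf (pchar_Fp qpr)) dvdn_prime2.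
have [h h2] : exists h : 'F_p, h ^+ 2 = -1.
  suff [h /eqP] : exists h : 'F_p, -1 = h ^+ 2 by exists h; apply/esym/eqP.
  apply: qchar_sqrtP => //; rewrite -signr_odd.
  by rewrite (_ : odd _ = false) //; move: p1; clear; lia.
have := quadratic_reciprocity_in pr p1 h2 two0 pK zP qK oq q0.
have -> : p%:R ^+ q.-1./2 = (qchar (p%:R : 'F_q))%:~R :> K.
  have := eq_int_char (a := p%:Z ^+ q.-1./2) (c := qchar (p%:R : 'F_q)) qpr qK.
  by rewrite qcharE // !rmorphXn /= -!pmulrn; apply.
rewrite /qchar (negPf q0) (negPf p0) -intrM.
case: ifP => _; case: ifP => _ //; rewrite ?mulr1 ?mul1r => /eqP;
  by rewrite -subr_eq0 -opprD oppr_eq0 (negPf two0).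
Qed.

(** * The value [2 b] of the trace of Frobenius *)

Section TraceValue.

Variables (b x p : nat) (D : int).
Hypotheses (b_gt0 : (0 < b)%N) (even_b : ~~ odd b).
Hypotheses (pr : prime p) (def_p : p = (x ^ 2 + b ^ 2)%N).
Hypothesis D_neq0 : D%:~R != 0 :> 'F_p.

Let iota := two_squares_iota b x p.
Let p1 := two_squares_mod4 b_gt0 even_b pr def_p.
Let iota2 : iota ^+ 2 = -1 := two_squares_iota_sqr b_gt0 even_b pr def_p.
Let ox := two_squares_odd b_gt0 even_b pr def_p.

Lemma frob_trace_two_squares : exists e : bool,
  ((-1) ^+ e * (x + b)%:Z = (-1) ^+ odd b./2 + 2 %[mod 4])%Z /\
  frob_trace D p =
    - (2 * (-1) ^+ e * (qre (D%:~R : 'F_p) * x%:Z + qim iota D%:~R * b%:Z)).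
Proof.
have [e [re im sgn]] := two_squares_jacobi b_gt0 even_b pr def_p.
exists e; split=> //; rewrite (frob_trace_jacobi pr p1 iota2 D_neq0) re im.
by ring.
Qed.

(** The real coordinate carries the odd number [x], the imaginary one carries
    [b]; only a nonresidue gives the trace [2 b] or [- 2 b]. *)
Lemma frob_trace_nonresidue (u : bool) :
    frob_trace D p = (-1) ^+ u * (2 * b%:Z) ->
  qchar (D%:~R : 'F_p) = -1.
Proof.
have [e [_ ->]] := frob_trace_two_squares.
rewrite (qcharE_quartic pr p1 iota2).
have [k kE] : exists k, x%:Z = 2 * k + 1 by exists x./2%:Z; move: ox; clear; lia.
have [j jE] : exists j, b%:Z = 2 * j by exists b./2%:Z; move: even_b; clear; lia.
rewrite kE jE.
by case: (quarticP pr p1 iota2 D_neq0) => //; clear; case: e; case: u;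
  rewrite ?expr1 ?expr0; lia.
Qed.

Lemma nonresidue_frob_trace : qchar (D%:~R : 'F_p) = -1 ->
  exists u : bool, frob_trace D p = (-1) ^+ u * (2 * b%:Z).
Proof.
have [e [_ ->]] := frob_trace_two_squares.
rewrite (qcharE_quartic pr p1 iota2).
case: (quarticP pr p1 iota2 D_neq0) => // _; [exists (~~ e) | exists e].
  by case: e; rewrite ?expr1 ?expr0; ring.
by case: e; rewrite ?expr1 ?expr0; ring.
Qed.

End TraceValue.

Section ConjugatePair.

Variables (b x x' p p' : nat) (s : bool).
Hypotheses (b_gt0 : (0 < b)%N) (even_b : ~~ odd b).
Hypotheses (pr : prime p) (def_p : p = (x ^ 2 + b ^ 2)%N).
Hypotheses (pr' : prime p') (def_p' : p' = (x' ^ 2 + b ^ 2)%N).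

Let iota := two_squares_iota b x p.
Let iota' := two_squares_iota b x' p'.
Let p1 := two_squares_mod4 b_gt0 even_b pr def_p.
Let p1' := two_squares_mod4 b_gt0 even_b pr' def_p'.
Let iota2 : iota ^+ 2 = -1 := two_squares_iota_sqr b_gt0 even_b pr def_p.
Let iota2' : iota' ^+ 2 = -1 := two_squares_iota_sqr b_gt0 even_b pr' def_p'.

(** Equality of two quartic characters, or conjugacy when [s] holds; it is said in
    coordinates because the characters live modulo different primes. *)
Definition twin_coords (n : int) : Prop :=
  qre (n%:~R : 'F_p') = qre (n%:~R : 'F_p) /\
  qim iota' n%:~R = (-1) ^+ s * qim iota n%:~R.

Lemma twin_coordsM (m n : int) :
  twin_coords m -> twin_coords n -> twin_coords (m * n).
Proof.
rewrite /twin_coords !rmorphM /=.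
have [-> ->] := qre_qimM pr p1 iota2 m%:~R n%:~R.
have [-> ->] := qre_qimM pr' p1' iota2' m%:~R n%:~R.
move=> [-> ->] [-> ->]; split; last by ring.
by rewrite mulrACA -expr2 sqrr_sign mul1r.
Qed.

Lemma twin_coords1 : twin_coords 1.
Proof.
rewrite /twin_coords !(qre1 pr p1 iota2) !(qre1 pr' p1' iota2').
by rewrite (qim1 pr p1 iota2) (qim1 pr' p1' iota2') mulr0.
Qed.

Lemma twin_coordsN1 : twin_coords (-1).
Proof.
rewrite /twin_coords !rmorphN1.
have := quartic_minus_pow4 pr p1 iota2 (oner_neq0 _).
have := quartic_minus_pow4 pr' p1' iota2' (oner_neq0 _).
rewrite !expr1n -(signr_odd _ (p %/ 4)) -(signr_odd _ (p' %/ 4)).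
rewrite (two_squares_odd_quarter b_gt0 even_b pr def_p).
rewrite (two_squares_odd_quarter b_gt0 even_b pr' def_p').
by move=> [-> ->] [-> ->]; rewrite mulr0.
Qed.

(** [-4] is a fourth power modulo any prime congruent to 1 modulo 4. *)
Lemma twin_coords4 : twin_coords 4.
Proof.
rewrite /twin_coords; have -> : (4 : int)%:~R = 4 :> 'F_p by [].
have -> : (4 : int)%:~R = 4 :> 'F_p' by [].
rewrite (four_eq_minus_pow4 iota2) (four_eq_minus_pow4 iota2').
have := quartic_minus_pow4 pr p1 iota2 (one_plus_iota_neq0 pr p1 iota2).
have := quartic_minus_pow4 pr' p1' iota2' (one_plus_iota_neq0 pr' p1' iota2').
rewrite -(signr_odd _ (p %/ 4)) -(signr_odd _ (p' %/ 4)).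
rewrite (two_squares_odd_quarter b_gt0 even_b pr def_p).
rewrite (two_squares_odd_quarter b_gt0 even_b pr' def_p').
by move=> [-> ->] [-> ->]; rewrite mulr0.
Qed.

Lemma twin_coords_prod (qs : seq nat) :
  {in qs, forall q : nat, twin_coords q%:Z} -> twin_coords (\prod_(q <- qs) q)%N%:Z.
Proof.
elim: qs => [_|q qs IH tqs]; first by rewrite big_nil; exact: twin_coords1.
rewrite big_cons PoszM; apply: twin_coordsM; first by apply: tqs; rewrite mem_head.
by apply: IH => r rqs; apply: tqs; rewrite inE rqs orbT.
Qed.

Lemma twin_coords_exp (m : int) (k : nat) : twin_coords m -> twin_coords (m ^+ k).
Proof.
move=> tm; elim: k => [|k IH]; first exact: twin_coords1.
by rewrite exprS; apply: twin_coordsM.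
Qed.

(** The sign relating the Jacobi sum to [x + i b] is the same for [p] and [p'],
    since [x'] and [x] agree modulo 4. *)
Lemma frob_trace_twin (D : int) (u : bool) :
    D%:~R != 0 :> 'F_p -> D%:~R != 0 :> 'F_p' -> (x' = x %[mod 4])%N ->
    twin_coords D -> frob_trace D p = (-1) ^+ u * (2 * b%:Z) ->
  frob_trace D p' = (-1) ^+ (s (+) u) * (2 * b%:Z).
Proof.
move=> D0 D0' xx' [re im] fr; have := frob_trace_nonresidue b_gt0 even_b pr def_p D0 fr.
have [e [sg frE]] := frob_trace_two_squares b_gt0 even_b pr def_p D0.
have [e' [sg' frE']] := frob_trace_two_squares b_gt0 even_b pr' def_p' D0'.
have ee' : e' = e.
  move: sg; rewrite -sg'.
  have [w Ew] : exists w : int, (x + b)%:Z = (x' + b)%:Z + 4 * w.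
    by exists ((x %/ 4)%:Z - (x' %/ 4)%:Z); move: xx'; clear; lia.
  have : odd (x + b).
    by rewrite oddD (two_squares_odd b_gt0 even_b pr def_p) (negPf even_b).
  by move: Ew; clear; case: e; case: e' => //; rewrite ?expr1 ?expr0; lia.
move: fr; rewrite frE' frE re im ee' (qcharE_quartic pr p1 iota2) -/iota.
case: (quarticP pr p1 iota2 D0) => //= fr _; rewrite !mul0r !add0r in fr *.
  have <- : (-1) ^+ s * - (2 * (-1) ^+ e * (1 * b%:Z)) = - (2 * (-1) ^+ e * ((-1) ^+ s * 1 * b%:Z)).
    by ring.
  by rewrite fr mulrA signr_addb.
have <- : (-1) ^+ s * - (2 * (-1) ^+ e * (-1 * b%:Z)) = - (2 * (-1) ^+ e * ((-1) ^+ s * -1 * b%:Z)).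
  by ring.
by rewrite fr mulrA signr_addb.
Qed.

End ConjugatePair.

(** * Counting residue classes *)

Lemma sum_crt (R : comPzRingType) (m n : nat) (f g : nat -> R) :
    (0 < m)%N -> (0 < n)%N -> coprime m n ->
    (forall c, f (c %% m)%N = f c) -> (forall c, g (c %% n)%N = g c) ->
  \sum_(c < m * n) f c * g c = (\sum_(c < m) f c) * (\sum_(c < n) g c).
Proof.
move=> m0 n0 co fP gP; rewrite big_distrlr /= pair_big /=.
pose h (c : 'I_(m * n)) : 'I_m * 'I_n := (Ordinal (ltn_pmod c m0), Ordinal (ltn_pmod c n0)).
have h_inj : injective h.
  move=> c d [/eqP cm /eqP cn]; apply: val_inj => /=.
  have := chinese_remainder co c d; rewrite cm cn /=.
  by rewrite !modn_small // => /eqP.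
have [h' hK h'K] : bijective h.
  by apply: inj_card_bij h_inj _; rewrite card_prod !card_ord.
rewrite [RHS](reindex h); last by exists h' => ? _.
by apply: eq_bigr => c _; rewrite fP gP.
Qed.

Lemma sum_crt_seq (R : comPzRingType) (qs : seq nat) (m : nat)
    (f : nat -> R) (h : nat -> nat -> R) :
    (0 < m)%N -> {in qs, forall q, 0 < q /\ coprime m q}%N ->
    {in qs &, forall q r, q != r -> coprime q r} -> uniq qs ->
    (forall c, f (c %% m)%N = f c) ->
    {in qs, forall q c, h q (c %% q)%N = h q c} ->
  \sum_(c < m * \prod_(q <- qs) q) f c * \prod_(q <- qs) h q c =
    (\sum_(c < m) f c) * \prod_(q <- qs) \sum_(c < q) h q c.
Proof.
elim: qs m f => [|q qs IH] m f m0 co_m co_q /= uq fP hP.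
  rewrite !big_nil muln1 mulr1; apply: eq_bigr => c _.
  by rewrite big_nil mulr1.
have [q0 mq] := co_m q (mem_head _ _).
case/andP: uq => qqs uqs.
have in_qs r : r \in qs -> r \in q :: qs by move=> rqs; rewrite inE rqs orbT.
rewrite !big_cons mulnA mulrA -sum_crt //; last by apply: hP; rewrite mem_head.
rewrite -(IH (m * q)%N (fun c => f c * h q c)) ?muln_gt0 ?m0 //.
- by apply: eq_bigr => c _; rewrite big_cons mulrA.
- move=> r rqs; have [r0 mr] := co_m r (in_qs r rqs); split=> //.
  rewrite coprimeMl mr; apply: co_q; rewrite ?mem_head ?in_qs //.
  by apply: contraNneq qqs => ->.
- by move=> r r' rqs r'qs; apply: co_q; apply: in_qs.
- move=> c; rewrite -[f (_ %% _)%N]fP -[h q (_ %% _)%N](hP q (mem_head _ _)).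
  by rewrite modn_dvdm ?dvdn_mulr // modn_dvdm ?dvdn_mull // fP hP // mem_head.
by move=> r rqs c; apply: hP; apply: in_qs.
Qed.

Lemma sum_residues_Fp (R : nmodType) (q : nat) (F : 'F_q -> R) : prime q ->
  \sum_(c < q) F c%:R = \sum_t F t.
Proof.
move=> pr; have [G GE] : exists G : nat -> R, forall c, F c%:R = G c by exists (fun c => F c%:R).
rewrite (eq_bigr (fun c : 'I_q => G c)) => [|c _]; last exact: GE.
rewrite -(big_mkord xpredT G) -[in LHS](Fp_cast pr) big_mkord.
by apply: eq_bigr => t _; rewrite -GE; congr (F _); exact: natr_Zp.
Qed.

(** Counting square roots leaves the sum of [qchar (c * (c + B))], where dividing
    by [c ^ 2] makes the argument run over all values but 1. *)
Lemma sum_qchar_sqrD (q : nat) (B : 'F_q) : prime q -> odd q -> B != 0 ->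
  \sum_t qchar (t ^+ 2 + B) = -1.
Proof.
move=> pr oq B0; have := sum_over_squares (fun c : 'F_q => qchar (c + B)) pr oq.
move=> ->; under eq_bigr do rewrite intz mulrDr mulr1.
have shift0 : \sum_(c : 'F_q) qchar (c + B) = 0.
  by rewrite -[RHS](sum_qchar pr oq) [RHS](reindex_inj (addIr B)).
rewrite big_split /= shift0 add0r.
rewrite (reindex_inj (mulfI B0)) /=.
transitivity (\sum_(c : 'F_q | c != 0) qchar (1 + c^-1)).
  rewrite [LHS](bigD1 0) //= mulr0 [X in _ * X]/qchar eqxx mulr0 add0r.
  apply: eq_bigr => c c0; rewrite -qcharM //.
  have -> : (B * c + B) * (B * c) = (B * c) ^+ 2 * (1 + c^-1).
    rewrite [RHS]mulrC expr2 [RHS]mulrA; congr (_ * _).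
    by rewrite [RHS]mulrC mulrDr mulr1 -mulrA divff // mulr1.
  by rewrite qcharM // qchar_sqr ?mul1r // mulf_neq0.
rewrite (reindex_inj (inv_inj (@invrK _))) /=.
rewrite (eq_bigl (fun c : 'F_q => c != 0)) => [|c]; last by rewrite invr_eq0.
have := sum_qchar pr oq; rewrite (reindex_inj (addrI 1)) (bigD1 0) //=.
rewrite addr0 qchar1 // => /eqP; rewrite addrC addr_eq0 => /eqP <-.
by apply: eq_bigr => c _; rewrite invrK.
Qed.

Lemma sum_sqrD_neq0 (q : nat) (B : 'F_q) : prime q -> odd q ->
  \sum_t (t ^+ 2 + B != 0)%:R = q%:Z - 1 - qchar (- B).
Proof.
move=> pr oq; have := card_sqrt (- B) pr oq.
rewrite -sum1_card -natz natr_sum big_mkcond /= => sq.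
transitivity (\sum_(t : 'F_q) (1 - (t ^+ 2 == - B)%:R : int)).
  by apply: eq_bigr => t _; rewrite addr_eq0; case: eqP.
rewrite sumrB sumr_const -[X in _ *+ X]/(#|'F_q|) card_Fp // natz.
transitivity (q%:Z - (1 + qchar (- B))); last by ring.
rewrite -sq; congr (_ - _); apply: eq_bigr => t _; rewrite inE.
by case: eqP.
Qed.

Lemma tau_primeE (q : nat) : prime q -> odd q ->
  (tau_prime q)%:Z = q%:Z - 1 - qchar (-1 : 'F_q).
Proof.
move=> pr oq; have q3 := odd_prime_gt2 oq pr.
rewrite /qchar oppr_eq0 oner_eq0 /tau_prime -signr_odd.
have n1 : (-1 == 1 :> 'F_q) = false.
  by apply/negbTE; rewrite eq_sym eq_oppr_neq0 ?oner_eq0.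
case: ifP => q4.
  rewrite (_ : odd _ = true) ?expr1 ?n1 ?subrr; last by move: q4; clear; lia.
  by move: q3; clear; lia.
rewrite (_ : odd _ = false) ?expr0 ?eqxx; last by move: q4 oq; clear; lia.
by move: q3; clear; lia.
Qed.

Lemma tau_prime_gt0 (q : nat) : prime q -> odd q -> (0 < tau_prime q)%N.
Proof.
move=> pr oq; have := odd_prime_gt2 oq pr; rewrite /tau_prime.
by case: ifP => _; lia.
Qed.


(** The class of [x] modulo 4 decides the sign of the Jacobi sum. *)
Definition modulus (qs : seq nat) : nat := (4 * \prod_(q <- qs) q)%N.

(** The classes that contain the numbers [x] for which [x ^ 2 + b ^ 2] may be a
    prime not dividing the modulus. *)
Definition admissible (b : nat) (qs : seq nat) (c : nat) : bool :=
  coprime (c ^ 2 + b ^ 2) (modulus qs).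

Lemma admissible_mod (b : nat) (qs : seq nat) (x c : nat) :
  (x = c %[mod modulus qs])%N -> admissible b qs x = admissible b qs c.
Proof.
move=> xc; rewrite /admissible -coprime_modl -[in RHS]coprime_modl.
by rewrite -modnDml -modnXm xc modnXm modnDml.
Qed.

Definition class_symbol (b : nat) (qs : seq nat) (P : pred nat) (c : nat) : int :=
  \prod_(q <- qs | P q) qchar ((c ^ 2 + b ^ 2)%:R : 'F_q).

Lemma coprime_prod_seq (n : nat) (qs : seq nat) :
  coprime n (\prod_(q <- qs) q)%N = all (coprime n) qs.
Proof.
elim: qs => [|q qs IH]; first by rewrite big_nil coprimen1.
by rewrite big_cons coprimeMr IH.
Qed.

Section Classes.

Variables (b : nat) (qs : seq nat) (P : pred nat).
Hypotheses (even_b : ~~ odd b) (uqs : uniq qs).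
Hypothesis qs_prime : {in qs, forall q, prime q /\ odd q}.
Hypothesis P_ndvd : forall q, P q -> ~~ (q %| b)%N.

Let M := modulus qs.

Lemma modulus_gt0 : (0 < M)%N.
Proof.
rewrite muln_gt0 /= big_seq; apply: prodn_cond_gt0 => q /qs_prime[pr _].
exact: prime_gt0.
Qed.

(* [U q] counts the admissible values of [x] modulo [q]. *)
Let U (q : nat) : int := \sum_(c < q) (~~ (q %| c ^ 2 + b ^ 2)%N)%:R.

Lemma admissibleE (c : nat) : (admissible b qs c)%:R =
  (odd c)%:R * \prod_(q <- qs) (~~ (q %| c ^ 2 + b ^ 2)%N)%:R :> int.
Proof.
rewrite /admissible /modulus coprimeMr coprime_prod_seq (_ : 4 = 2 ^ 2)%N //.
rewrite coprime_pexpr // coprimen2 oddD !oddX (negPf even_b) addbF /= -mulnb natrM.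
congr (_ * _); elim: qs qs_prime => [|q rs IH] rs_prime; first by rewrite big_nil.
rewrite big_cons -IH /= => [|r rrs]; last by apply: rs_prime; rewrite inE rrs orbT.
have [pr _] := rs_prime q (mem_head _ _).
by rewrite coprime_sym prime_coprime // -mulnb natrM.
Qed.

Lemma sqrD_mod (q c : nat) : ((c %% q) ^ 2 + b ^ 2 = c ^ 2 + b ^ 2 %[mod q])%N.
Proof. by rewrite -modnDml modnXm modnDml. Qed.

Lemma sqrD_dvd_mod (q c : nat) :
  (q %| (c %% q) ^ 2 + b ^ 2)%N = (q %| c ^ 2 + b ^ 2)%N.
Proof. by rewrite /dvdn sqrD_mod. Qed.

Lemma sqrD_Fp (q c : nat) : prime q ->
  ((c %% q) ^ 2 + b ^ 2)%:R = (c ^ 2 + b ^ 2)%:R :> 'F_q.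
Proof. by move=> pr; rewrite -Fp_nat_mod // sqrD_mod Fp_nat_mod. Qed.

Let qs_crt : {in qs, forall q, 0 < q /\ coprime 4 q}%N.
Proof.
move=> q /qs_prime[pr oq]; split; first exact: prime_gt0.
by rewrite (_ : 4 = 2 ^ 2)%N // coprime_pexpl // coprime2n.
Qed.

Let qs_coprime : {in qs &, forall q r, q != r -> coprime q r}.
Proof.
move=> q r /qs_prime[pr _] /qs_prime[pr' _] qr.
by rewrite prime_coprime // dvdn_prime2.
Qed.

Let odd_mod4 (c : nat) : odd (c %% 4) = odd c. Proof. by lia. Qed.

Lemma count_admissible : \sum_(c < M) (admissible b qs c)%:R = 2 * \prod_(q <- qs) U q :> int.
Proof.
transitivity (\sum_(c < M) (odd c)%:R * \prod_(q <- qs) (~~ (q %| c ^ 2 + b ^ 2)%N)%:R : int).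
  by apply: eq_bigr => c _; exact: admissibleE.
rewrite (sum_crt_seq (f := fun c => (odd c)%:R)
          (h := fun q c => (~~ (q %| c ^ 2 + b ^ 2)%N)%:R)) //.
- by rewrite !big_ord_recl big_ord0.
- by move=> c; rewrite odd_mod4.
by move=> q _ c; rewrite sqrD_dvd_mod.
Qed.

Lemma U_Fp (q : nat) : prime q -> odd q ->
  U q = q%:Z - 1 - qchar (- (b%:R ^+ 2 : 'F_q)).
Proof.
move=> pr oq; rewrite -sum_sqrD_neq0 // -(sum_residues_Fp _ pr).
apply: eq_bigr => c _.
by rewrite (dvdn_pcharf (pchar_Fp pr)) natrD !natrX.
Qed.

Lemma U_tau (q : nat) : prime q -> odd q -> ~~ (q %| b)%N -> U q = (tau_prime q)%:Z.
Proof.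
move=> pr oq qb; rewrite U_Fp // tau_primeE // -[- (b%:R ^+ 2)]mulN1r qcharM // qchar_sqr ?mulr1 //.
by rewrite -(dvdn_pcharf (pchar_Fp pr)).
Qed.

Lemma U_gt0 (q : nat) : prime q -> odd q -> 0 < U q.
Proof.
move=> pr oq; have [qb|qb] := boolP (q %| b)%N; last first.
  by rewrite U_tau // ltz_nat tau_prime_gt0.
have b0 : b%:R = 0 :> 'F_q by apply/eqP; rewrite -(dvdn_pcharf (pchar_Fp pr)).
rewrite U_Fp // b0 expr0n oppr0 /qchar eqxx subr0.
by have := prime_gt1 pr; lia.
Qed.

Lemma count_admissible_gt0 : 0 < \sum_(c < M) (admissible b qs c)%:R :> int.
Proof.
rewrite count_admissible mulr_gt0 // big_seq prodr_gt0 // => q /qs_prime[pr oq].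
exact: U_gt0.
Qed.

(** On admissible classes the two sums differ, at each prime selected by [P],
    by the factor [-1 / tau_prime q]: a quadratic polynomial without double
    root has character sum -1. *)
Lemma sum_class_symbol :
  (\sum_(c < M) (admissible b qs c)%:R * class_symbol b qs P c) *
    \prod_(q <- qs | P q) (tau_prime q)%:Z =
  (\sum_(c < M) (admissible b qs c)%:R) * (-1) ^+ count P qs :> int.
Proof.
pose h (q c : nat) : int := if P q then qchar ((c ^ 2 + b ^ 2)%:R : 'F_q)
                      else (~~ (q %| c ^ 2 + b ^ 2)%N)%:R.
have -> : \sum_(c < M) (admissible b qs c)%:R * class_symbol b qs P c =
          \sum_(c < M) (odd c)%:R * \prod_(q <- qs) h q c.
  apply: eq_bigr => c _; rewrite admissibleE -mulrA; congr (_ * _).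
  rewrite /class_symbol [X in _ * X]big_mkcond -big_split /= big_seq [RHS]big_seq.
  apply: eq_bigr => q /qs_prime[pr oq]; rewrite /h; case: ifP => _; rewrite ?mulr1 //.
  rewrite (dvdn_pcharf (pchar_Fp pr)).
  by case: eqP => [->|_]; rewrite ?mul0r ?mul1r // /qchar eqxx.
rewrite (sum_crt_seq (f := fun c => (odd c)%:R) (h := h)) //; first last.
- move=> q qqs c; rewrite /h sqrD_dvd_mod sqrD_Fp //.
  by have [] := qs_prime qqs.
- by move=> c; rewrite odd_mod4.
have -> : \sum_(c < 4) (odd c)%:R = 2 :> int by rewrite !big_ord_recl big_ord0.
have -> : (-1) ^+ count P qs = \prod_(q <- qs) (if P q then -1 else 1) :> int.
  by rewrite -big_mkcond big_const_seq iter_mulr mulr1.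
rewrite count_admissible [X in _ * X]big_mkcond /= -!mulrA; congr (_ * _).
rewrite -!big_split /= big_seq [RHS]big_seq; apply: eq_bigr => q /qs_prime[pr oq].
rewrite /h; case: ifP => Pq; last by rewrite !mulr1.
rewrite U_tau ?P_ndvd // mulrC; congr (_ * _).
rewrite (eq_bigr (fun c : 'I_q => qchar ((c%:R : 'F_q) ^+ 2 + b%:R ^+ 2))); last first.
  by move=> c _; rewrite natrD !natrX.
rewrite (sum_residues_Fp (fun t : 'F_q => qchar (t ^+ 2 + b%:R ^+ 2))) //.
by rewrite sum_qchar_sqrD // expf_neq0 // -(dvdn_pcharf (pchar_Fp pr)) P_ndvd.
Qed.

End Classes.

(** * The sign of the trace on residue classes *)

Section ClassSigns.

Variables (b : nat) (D : int) (neg : bool) (sigma : nat) (ps qs ls : seq nat).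

Let Qs := ps ++ qs ++ ls.
Let M := modulus Qs.
Let L := (\prod_(q <- Qs) q)%N.

Hypotheses (b_gt0 : (0 < b)%N) (even_b : ~~ odd b).
Hypotheses (Qs_prime : {in Qs, forall q, prime q /\ odd q}) (uQs : uniq Qs).
Hypothesis sigma02 : sigma = 0%N \/ sigma = 2%N.
Hypothesis D_def : D = (-1) ^+ neg *
  (2 ^ sigma * \prod_(p <- ps) p * (\prod_(q <- qs) q) ^ 2
    * (\prod_(l <- ls) l) ^ 3)%N%:Z.

(** The odd primes that divide [D] to an odd power but do not divide [b]. *)
Definition odd_part_primes (ps ls : seq nat) (b q : nat) : bool :=
  (q \in ps ++ ls) && ~~ (q %| b)%N.

Let P := odd_part_primes ps ls b.

Let ps_Qs q : q \in ps -> q \in Qs. Proof. by rewrite /Qs !mem_cat => ->. Qed.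
Let qs_Qs q : q \in qs -> q \in Qs. Proof. by rewrite /Qs !mem_cat => ->; rewrite orbT. Qed.
Let ls_Qs q : q \in ls -> q \in Qs. Proof. by rewrite /Qs !mem_cat => ->; rewrite !orbT. Qed.

Let LE : L = (\prod_(p <- ps) p * (\prod_(q <- qs) q * \prod_(l <- ls) l))%N.
Proof. by rewrite /L /Qs !big_cat. Qed.

Let prime_dvd_L q : q \in Qs -> (q %| L)%N.
Proof. by move=> qQ; rewrite /L (big_rem q) //= dvdn_mulr. Qed.

Let M_gt0 : (0 < M)%N. Proof. exact: modulus_gt0. Qed.

Section Prime.

Variables (x p : nat).
Hypotheses (adm : admissible b Qs x) (pr : prime p) (def_p : p = (x ^ 2 + b ^ 2)%N).

Let p1 := two_squares_mod4 b_gt0 even_b pr def_p.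

Lemma admissible_coprime : coprime p L.
Proof. by move: adm; rewrite /admissible -def_p /modulus coprimeMr => /andP[]. Qed.

Lemma admissible_neq (q : nat) : q \in Qs -> q != p.
Proof.
move=> qQ; have := admissible_coprime; rewrite prime_coprime //.
by apply: contraNneq => <-; exact: prime_dvd_L.
Qed.

Lemma admissible_D_neq0 : D%:~R != 0 :> 'F_p.
Proof.
rewrite -(dvdz_pcharf (pchar_Fp pr)) D_def dvdzE abszMsign !absz_nat.
rewrite -prime_coprime // !coprimeMr.
have := admissible_coprime; rewrite LE !coprimeMr => /and3P[-> cq cl].
have c2 : coprime p 2 by rewrite coprimen2; exact: odd_mod4_1 p1.
by rewrite coprimeXr // cq cl.
Qed.

Lemma admissible_ndvd_2D : ~~ (p%:Z %| 2 * D)%Z.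
Proof.
rewrite (dvdz_pcharf (pchar_Fp pr)) rmorphM mulf_neq0 ?admissible_D_neq0 //.
exact: (prime_two_neq0 pr (odd_mod4_1 p1)).
Qed.

(* When [q] divides [b], the symbol is that of the square [x ^ 2]. *)
Let reciprocal q : q \in Qs ->
  qchar (q%:R : 'F_p) = if (q %| b)%N then 1 else qchar ((x ^ 2 + b ^ 2)%:R : 'F_q).
Proof.
move=> qQ; have [prq oq] := Qs_prime qQ; have qp := admissible_neq qQ.
rewrite (quadratic_reciprocity_mod4 pr p1 prq oq qp) def_p; case: ifP => // qb.
rewrite natrD !natrX.
have -> : b%:R = 0 :> 'F_q by apply/eqP; rewrite -(dvdn_pcharf (pchar_Fp prq)).
rewrite expr0n addr0 qchar_sqr //; apply/negP.
rewrite -(dvdn_pcharf (pchar_Fp prq)) => qx.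
have : (q %| p)%N by rewrite def_p dvdn_add // -mulnn dvdn_mulr.
by rewrite dvdn_prime2 // (negPf qp).
Qed.

Let qchar_prod (rs : seq nat) :
  qchar ((\prod_(q <- rs) q)%N%:R : 'F_p) = \prod_(q <- rs) qchar (q%:R : 'F_p).
Proof.
have op := odd_mod4_1 p1.
elim: rs => [|q rs IH]; first by rewrite !big_nil qchar1.
by rewrite !big_cons natrM qcharM // IH.
Qed.

Let prod_Qs_neq0 (rs : seq nat) : {subset rs <= Qs} ->
  (\prod_(q <- rs) q)%N%:R != 0 :> 'F_p.
Proof.
move=> rsQ; rewrite -(dvdn_pcharf (pchar_Fp pr)) -prime_coprime // coprime_prod_seq.
apply/allP => q /rsQ qQ; rewrite prime_coprime // dvdn_prime2 // 1?eq_sym.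
  exact: admissible_neq.
by have [] := Qs_prime qQ.
Qed.

Lemma qchar_D_symbol : qchar (D%:~R : 'F_p) = class_symbol b Qs P x.
Proof.
have op := odd_mod4_1 p1; have i2 := two_squares_iota_sqr b_gt0 even_b pr def_p.
have cq := prod_Qs_neq0 qs_Qs; have cl := prod_Qs_neq0 ls_Qs.
have sq (a : 'F_p) : a != 0 -> qchar a * qchar a = 1.
  by move=> a0; rewrite -qcharM // -expr2 qchar_sqr.
have qsgn : qchar ((-1) ^+ neg : 'F_p) = 1.
  by case: neg; rewrite ?expr1 ?expr0 ?(qcharN1 pr p1 i2) ?qchar1.
have q2 : qchar ((2 ^ sigma)%N%:R : 'F_p) = 1.
  case: sigma02 => ->; first exact: qchar1.
  by rewrite natrX qchar_sqr // prime_two_neq0.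
rewrite D_def rmorphM rmorph_sign /= -pmulrn !natrM !qcharM // qsgn q2 !mul1r.
rewrite !sq // !mulr1 !qchar_prod.
rewrite /class_symbol /Qs !big_cat /= [X in _ * (X * _)]big1_seq ?mul1r; last first.
  move=> q /andP[+ qq]; rewrite /P /odd_part_primes mem_cat => /andP[/orP[qp|ql] _].
    by move: uQs; rewrite /Qs cat_uniq => /and3P[_ /hasPn/(_ q)]; rewrite mem_cat qq /= qp => /(_ isT).
  by move: uQs; rewrite /Qs !cat_uniq => /and5P[_ _ _ /hasPn/(_ q ql)]; rewrite /= qq.
congr (_ * _); rewrite [RHS]big_mkcond /= big_seq [RHS]big_seq; apply: eq_bigr => q qr.
  rewrite reciprocal ?ps_Qs // /P /odd_part_primes mem_cat qr /=.
  by case: (q %| b)%N.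
rewrite reciprocal ?ls_Qs // /P /odd_part_primes mem_cat qr orbT /=.
by case: (q %| b)%N.
Qed.

End Prime.

(** One prime of the class suffices: on an admissible class all primes give the
    same sign. *)
Definition class_sign (u : bool) (c : nat) : Prop :=
  exists x p : nat, [/\ (x = c %[mod M])%N, prime p, p = (x ^ 2 + b ^ 2)%N
    & frob_trace D p = (-1) ^+ u * (2 * b%:Z)].

Lemma frob_trace_class (x p x' p' : nat) (s u : bool) :
    admissible b Qs x -> prime p -> p = (x ^ 2 + b ^ 2)%N ->
    admissible b Qs x' -> prime p' -> p' = (x' ^ 2 + b ^ 2)%N ->
    (x' = x %[mod 4])%N -> {in Qs, forall q, x'%:R = (-1) ^+ s * x%:R :> 'F_q} ->
    frob_trace D p = (-1) ^+ u * (2 * b%:Z) ->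
  frob_trace D p' = (-1) ^+ (s (+) u) * (2 * b%:Z).
Proof.
move=> adm pr def_p adm' pr' def_p' x4 xq.
apply: (frob_trace_twin b_gt0 even_b pr def_p pr' def_p' _ _ x4).
- exact: admissible_D_neq0 adm pr def_p.
- exact: admissible_D_neq0 adm' pr' def_p'.
have tM := twin_coordsM b_gt0 even_b pr def_p pr' def_p' (s := s).
have tX := twin_coords_exp b_gt0 even_b pr def_p pr' def_p' (s := s).
have tprod (rs : seq nat) : {subset rs <= Qs} ->
    twin_coords b x x' p p' s (\prod_(q <- rs) q)%N%:Z.
  move=> rsQ; apply: (twin_coords_prod b_gt0 even_b pr def_p pr' def_p') => q /rsQ qQ.
  have [prq oq] := Qs_prime qQ.
  apply: (quartic_char_pair b_gt0 even_b pr def_p pr' def_p' prq oq); last exact: xq.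
    exact: admissible_neq adm pr def_p _ qQ.
  exact: admissible_neq adm' pr' def_p' _ qQ.
rewrite D_def; apply: (tM).
  exact: tX _ _ (twin_coordsN1 s b_gt0 even_b pr def_p pr' def_p').
rewrite !PoszM; apply: (tM); [apply: (tM); [apply: (tM)|]|].
- case: sigma02 => ->; first exact: (twin_coords1 s b_gt0 even_b pr def_p pr' def_p').
  exact: (twin_coords4 s b_gt0 even_b pr def_p pr' def_p').
- exact: tprod ps_Qs.
- by apply: (tM); exact: tprod qs_Qs.
by apply: (tM); [|apply: (tM)]; exact: tprod ls_Qs.
Qed.

Lemma class_sign_shared (c x p : nat) (u : bool) :
    class_sign u c -> admissible b Qs c -> (x = c %[mod M])%N ->
    prime p -> p = (x ^ 2 + b ^ 2)%N ->
  frob_trace D p = (-1) ^+ u * (2 * b%:Z).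
Proof.
move=> [x0 [p0 [x0c pr0 def_p0 fr0]]] adm xc pr def_p.
have x_x0 : (x = x0 %[mod M])%N by rewrite xc.
rewrite -[u]/(false (+) u); apply: (frob_trace_class _ pr0 def_p0 _ pr def_p _ _ fr0).
- by rewrite (admissible_mod b x0c).
- by rewrite (admissible_mod b xc).
- have dM : (4 %| M)%N by rewrite dvdn_mulr.
  by rewrite -(modn_dvdm x dM) x_x0 modn_dvdm.
move=> q qQ; have [prq _] := Qs_prime qQ; rewrite expr0 mul1r.
have dM : (q %| M)%N by rewrite dvdn_mull // prime_dvd_L.
by rewrite -(Fp_nat_mod prq x) -(modn_dvdm x dM) x_x0 modn_dvdm // Fp_nat_mod.
Qed.

(** Multiplying [x] by it preserves the sign of the Jacobi sum, which depends on
    [x] modulo 4, and conjugates the quartic character of every odd prime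
    dividing [D]. *)
Definition reflector : nat := chinese 4 L 1 L.-1.

Let L_gt0 : (0 < L)%N.
Proof. by have := M_gt0; rewrite muln_gt0. Qed.

Let co4L : coprime 4 L.
Proof.
rewrite (_ : 4 = 2 ^ 2)%N // coprime_pexpl // coprime_prod_seq.
by apply/allP => q /Qs_prime[_]; rewrite coprime2n.
Qed.

Lemma reflector_mod4 : (reflector = 1 %[mod 4])%N.
Proof. exact: chinese_modl. Qed.

Lemma reflector_modL : (L %| reflector.+1)%N.
Proof.
have e1 : (reflector = L.-1 %[mod L])%N by exact: chinese_modr.
by rewrite -addn1 /dvdn -modnDml e1 modnDml addn1 prednK // modnn.
Qed.

Lemma reflector_Fp (q : nat) : q \in Qs -> reflector%:R = -1 :> 'F_q.
Proof.
move=> qQ; have [prq _] := Qs_prime qQ.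
apply/eqP; rewrite -addr_eq0 -[X in _ + X]/(1%:R) -natrD addn1.
by rewrite -(dvdn_pcharf (pchar_Fp prq)) (dvdn_trans (prime_dvd_L qQ) reflector_modL).
Qed.

Lemma reflector_sqr : (reflector * reflector = 1 %[mod M])%N.
Proof.
have r_gt0 : (0 < reflector)%N.
  by case: reflector reflector_mod4.
apply/eqP; rewrite /M /modulus -/L chinese_remainder //; apply/andP; split.
  by rewrite -modnMm reflector_mod4.
rewrite eqn_mod_dvd ?muln_gt0 ?r_gt0 // mulnn -{2}(exp1n 2) subn_sqr.
by rewrite dvdn_mull // addn1 reflector_modL.
Qed.

Let reflect_class (c : 'I_M) : 'I_M := Ordinal (ltn_pmod (reflector * c) M_gt0).

Let reflect_classK : involutive reflect_class.
Proof.
move=> c; apply: val_inj => /=.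
by rewrite modnMmr mulnA -modnMml reflector_sqr modnMml mul1n modn_small.
Qed.

Let admissible_reflect (c : 'I_M) : admissible b Qs c -> admissible b Qs (reflect_class c).
Proof.
rewrite (admissible_mod b (modn_mod _ _)) /admissible -/M => adm.
rewrite -coprime_modl expnMn -modnDml -modnMml -mulnn reflector_sqr modnMml modnDml.
by rewrite mul1n coprime_modl.
Qed.

Lemma class_sign_reflect (c : 'I_M) (x p : nat) (u : bool) :
    class_sign u c -> admissible b Qs c -> (x = reflect_class c %[mod M])%N ->
    prime p -> p = (x ^ 2 + b ^ 2)%N ->
  frob_trace D p = (-1) ^+ (~~ u) * (2 * b%:Z).
Proof.
move=> [x0 [p0 [x0c pr0 def_p0 fr0]]] adm xc pr def_p.
have x_x0 : (x = reflector * x0 %[mod M])%N.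
  by rewrite xc /= modn_mod -modnMmr -x0c modnMmr.
rewrite -[~~ u]/(true (+) u); apply: (frob_trace_class _ pr0 def_p0 _ pr def_p _ _ fr0).
- by rewrite (admissible_mod b x0c).
- by rewrite (admissible_mod b xc) admissible_reflect.
- have dM : (4 %| M)%N by rewrite dvdn_mulr.
  by rewrite -(modn_dvdm x dM) x_x0 modn_dvdm // -modnMml reflector_mod4 modnMml mul1n.
move=> q qQ; have [prq _] := Qs_prime qQ; rewrite expr1 -(reflector_Fp qQ) -natrM.
have dM : (q %| M)%N by rewrite dvdn_mull // prime_dvd_L.
by rewrite -(Fp_nat_mod prq x) -(modn_dvdm x dM) x_x0 modn_dvdm // Fp_nat_mod.
Qed.

Hypothesis class_has_prime : forall c : nat, admissible b Qs c ->
  exists x p : nat, [/\ (x = c %[mod M])%N, prime p & p = (x ^ 2 + b ^ 2)%N].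

Definition sign_classes (u : bool) : {set 'I_M} :=
  [set c : 'I_M | admissible b Qs c && `[< class_sign u c >]]%SET.

Let reflect_sign_classes (u : bool) (c : 'I_M) :
  c \in sign_classes u -> reflect_class c \in sign_classes (~~ u).
Proof.
rewrite !inE => /andP[adm /asboolP sgn]; have adm' := admissible_reflect adm.
rewrite adm' /=; apply/asboolP; have [x [p [xc pr def_p]]] := class_has_prime adm'.
by exists x, p; split=> //; exact: class_sign_reflect sgn adm xc pr def_p.
Qed.

Lemma card_sign_classes (u : bool) : #|sign_classes (~~ u)| = #|sign_classes u|.
Proof.
have le v : (#|sign_classes v| <= #|sign_classes (~~ v)|)%N.
  rewrite -(card_imset _ (inv_inj reflect_classK)); apply: subset_leq_card.
  by apply/fintype.subsetP => d /imsetP[c cS ->]; exact: reflect_sign_classes.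
by apply/eqP; rewrite eqn_leq le -{2}(negbK u) le.
Qed.

Let class_symbol_mod (x c : nat) : (x = c %[mod M])%N ->
  class_symbol b Qs P x = class_symbol b Qs P c.
Proof.
move=> xc; rewrite /class_symbol big_seq_cond [RHS]big_seq_cond.
apply: eq_bigr => q /andP[qQ _]; have [prq _] := Qs_prime qQ.
have dM : (q %| M)%N by rewrite dvdn_mull // prime_dvd_L.
rewrite -[in LHS](sqrD_Fp b x prq) -[in RHS](sqrD_Fp b c prq).
by rewrite -(modn_dvdm x dM) xc modn_dvdm.
Qed.

Let class_symbol_pm1 (c : nat) : admissible b Qs c ->
  class_symbol b Qs P c = 1 \/ class_symbol b Qs P c = -1.
Proof.
rewrite /admissible /modulus coprimeMr coprime_prod_seq => /andP[_ /allP adm].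
rewrite /class_symbol big_seq_cond.
apply: (big_ind (fun v : int => v = 1 \/ v = -1)); first by left.
  by move=> v w [] -> [] ->; rewrite ?mulr1 ?mul1r ?mulrNN; [left|right|right|left].
move=> q /andP[qQ _]; have [prq _] := Qs_prime qQ.
have : (c ^ 2 + b ^ 2)%:R != 0 :> 'F_q.
  by rewrite -(dvdn_pcharf (pchar_Fp prq)) -prime_coprime // coprime_sym adm.
by rewrite /qchar => /negPf ->; case: ifP; [left|right].
Qed.

Let class_sign_symbol (u : bool) (c : nat) :
  class_sign u c -> admissible b Qs c -> class_symbol b Qs P c = -1.
Proof.
move=> [x [p [xc pr def_p fr]]] adm.
have admx : admissible b Qs x by rewrite (admissible_mod b xc).
rewrite -(class_symbol_mod xc) -(qchar_D_symbol admx pr def_p).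
exact: (frob_trace_nonresidue b_gt0 even_b pr def_p (admissible_D_neq0 admx pr def_p) fr).
Qed.

Let class_sign_exists (c : nat) :
  admissible b Qs c -> class_symbol b Qs P c = -1 -> exists u, class_sign u c.
Proof.
move=> adm sym; have [x [p [xc pr def_p]]] := class_has_prime adm.
have admx : admissible b Qs x by rewrite (admissible_mod b xc).
have := nonresidue_frob_trace b_gt0 even_b pr def_p (admissible_D_neq0 admx pr def_p).
rewrite (qchar_D_symbol admx pr def_p) (class_symbol_mod xc) => /(_ sym)[u fr].
by exists u, x, p.
Qed.

Let class_sign_unique (c : nat) :
  admissible b Qs c -> class_sign true c -> class_sign false c -> False.
Proof.
move=> adm [x [p [xc pr def_p fr]]] sgn.
move: fr; rewrite (class_sign_shared sgn adm xc pr def_p) expr0 expr1.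
by move: b_gt0; clear; lia.
Qed.

(** The nonresidue classes, counted by [1 - class_symbol], fall into two halves
    of equal size exchanged by the reflection. *)
Lemma card_sign_classesE (u : bool) :
  4 * #|sign_classes u|%:Z = \sum_(c < M) (admissible b Qs c)%:R -
    \sum_(c < M) (admissible b Qs c)%:R * class_symbol b Qs P c.
Proof.
have -> : 4 * #|sign_classes u|%:Z =
    2 * (#|sign_classes true|%:Z + #|sign_classes false|%:Z).
  have e1 : #|sign_classes false| = #|sign_classes true| := card_sign_classes true.
  by case: u; rewrite e1; ring.
have cardE v : #|sign_classes v|%:Z = \sum_(c < M) (c \in sign_classes v)%:R.
  by rewrite -sum1_card -natz natr_sum big_mkcond; apply: eq_bigr => c _; case: (_ \in _).
rewrite !cardE -big_split /= mulr_sumr -sumrB; apply: eq_bigr => c _.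
rewrite !inE; have [adm|_] := boolP (admissible b Qs c); last by rewrite !mul0r subrr.
rewrite mul1r /=; case: (class_symbol_pm1 adm) => sym.
  by rewrite sym !asboolF // => sgn; move: sym; rewrite (class_sign_symbol sgn adm).
rewrite sym; have [v sgn] := class_sign_exists adm sym.
case: v sgn => sgn; rewrite (asboolT sgn) asboolF //.
  by move=> sgn'; exact: class_sign_unique adm sgn sgn'.
by move=> sgn'; exact: class_sign_unique adm sgn' sgn.
Qed.

End ClassSigns.

(** * Densities from the conjectural asymptotics *)

Local Open Scope classical_set_scope.
Local Open Scope ring_scope.

(** With [s] the fourth root of [n + 1], the quotient is [4 ln s / s ^ 2 < 4 / s]. *)
Lemma ln_over_sqrt_cvg0 (R : realType) :
  (fun n : nat => ln n.+1%:R / Num.sqrt n.+1%:R : R) @ \oo --> (0 : R).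
Proof.
have root0 : (fun n : nat => 4 * Num.sqrt (Num.sqrt (harmonic n)) : R) @ \oo --> (0 : R).
  rewrite -(mulr0 4); apply: cvgMl_tmp.
  have s0 : Num.sqrt (Num.sqrt 0) = 0 :> R by rewrite !sqrtr0.
  rewrite -[X in _ --> X]s0.
  apply: continuous_cvg; first exact: sqrt_continuous.
  apply: continuous_cvg; first exact: sqrt_continuous.
  exact: cvg_harmonic.
apply: (squeeze_cvgr _ (cvg_cst 0) root0); apply: nearW => n /=.
have n1 : 1 <= n.+1%:R :> R by rewrite ler1n.
have n0 : 0 < n.+1%:R :> R by rewrite ltr0n.
pose s : R := Num.sqrt (Num.sqrt n.+1%:R).
have s_gt0 : 0 < s by rewrite !sqrtr_gt0.
have s2 : Num.sqrt n.+1%:R = s ^+ 2 by rewrite sqr_sqrtr // sqrtr_ge0.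
have s4 : n.+1%:R = s ^+ 4 by rewrite (exprM s 2 2) -s2 sqr_sqrtr // ltW.
rewrite divr_ge0 ?sqrtr_ge0 ?ln_ge0 //=.
have -> : Num.sqrt (Num.sqrt (harmonic n)) = s^-1 :> R.
  by rewrite /harmonic /= !sqrtrV // ?sqrtr_ge0 // ltW.
rewrite s2 s4 lnXn // ler_pdivrMr ?exprn_gt0 // -mulrA -[ln s *+ 4]mulr_natl ler_pM2l //.
by rewrite exprS expr1 mulrA mulVf ?lt0r_neq0 // mul1r ltW // ln_sublinear.
Qed.

Lemma ratio_of_sums_cvg (R : realType) (m : nat) (C E : 'I_m -> nat -> R)
    (a e : 'I_m -> R) (g : nat -> R) :
    (\forall n \near \oo, g n != 0) ->
    (forall c, (fun n => C c n / g n) @ \oo --> a c) ->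
    (forall c, (fun n => E c n / g n) @ \oo --> e c) ->
    \sum_c a c != 0 ->
  (fun n => (\sum_c E c n) / (\sum_c C c n)) @ \oo --> (\sum_c e c) / (\sum_c a c).
Proof.
move=> g0 Ca Ee sa0.
have sum_cvg (F : 'I_m -> nat -> R) (l : 'I_m -> R) :
    (forall c, (fun n => F c n / g n) @ \oo --> l c) ->
    (fun n => \sum_c (F c n / g n)) @ \oo --> \sum_c l c.
  by move=> Fl; apply: cvg_big => // -[x y]; exact: add_continuous.
apply: cvg_trans (cvgM (sum_cvg _ _ Ee) (cvgV sa0 (sum_cvg _ _ Ca))).
apply: near_eq_cvg; near=> n => /=.
have gn : g n != 0 by near: n.
suff /esym : (\sum_c (E c n / g n)) * (\sum_c (C c n / g n))^-1 =
    (\sum_c E c n) / (\sum_c C c n) by [].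
by rewrite -!mulr_suml invfM invrK mulrACA mulVf // mulr1.
Unshelve. all: by end_near. Qed.

Section ClassAsymptotics.

Variables (R : realType) (b : nat) (Qs : seq nat).
Hypotheses (b_gt0 : (0 < b)%N) (even_b : ~~ odd b).
Hypotheses (Qs_prime : {in Qs, forall q, prime q /\ odd q}).
Hypothesis HL : Hardy_Littlewood_conjecture R.

Let M := modulus Qs.
Let M_gt0 : (0 < M)%N. Proof. exact: modulus_gt0. Qed.
Let M_even : (2 %| M)%N. Proof. by rewrite dvdn_mulr. Qed.

Definition class_primes (c n : nat) : {set 'I_n} :=
  [set p : 'I_n | prime p &&
     `[< exists x : nat, (x = c %[mod M])%N /\ p = (x ^ 2 + b ^ 2)%N :> nat >]]%SET.

Let quad_a : int := (M ^ 2)%N%:Z.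
Let quad_b (c : nat) : int := (2 * M * c)%N%:Z.
Let quad_c (c : nat) : int := (c ^ 2 + b ^ 2)%N%:Z.

Lemma HL_count_class (c n : nat) : (c < M)%N ->
  HL_count quad_a (quad_b c) (quad_c c) n = #|class_primes c n|.
Proof.
move=> cM; apply: eq_card => p.
(* The value of the quadratic polynomial at [y] is that of [x ^ 2 + b ^ 2] at
   [x = M y + c]. *)
have expand y : ((M * y + c) ^ 2 + b ^ 2)%N%:Z =
    quad_a * y%:Z ^+ 2 + quad_b c * y%:Z + quad_c c.
  by rewrite /quad_a /quad_b /quad_c -!mulnn !(PoszD, PoszM); ring.
rewrite [RHS]finset.inE; apply/idP/idP => [/set_mem|] /andP[pr /asboolP].
  move=> [y py]; rewrite pr; apply/asboolP; exists (M * y + c)%N.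
  split; first by rewrite mulnC modnMDl.
  by apply/eqP; rewrite -eqz_nat expand py.
move=> [x [xc px]]; apply/mem_set => /=; rewrite pr; apply/asboolP.
exists (x %/ M)%N; rewrite -expand px; congr (Posz (_ ^ 2 + _)%N).
by rewrite {1}(divn_eq x M) xc (modn_small cM) mulnC.
Qed.

Let discE e : disc quad_a (quad_b e) (quad_c e) = - (4 * M%:Z ^+ 2 * b%:Z ^+ 2).
Proof. by rewrite /disc /quad_a /quad_b /quad_c -!mulnn !(PoszD, PoszM); ring. Qed.

(** The constant of the conjecture only depends on the modulus: the primes
    dividing the leading coefficient divide the middle one, and the
    discriminant is [- 4 M ^ 2 b ^ 2]. *)
Lemma HL_delta_class (c d : nat) :
  HL_delta R quad_a (quad_b c) (quad_c c) = HL_delta R quad_a (quad_b d) (quad_c d).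
Proof.
have gcd2 e : gcdz 2 (quad_a + quad_b e) = 2.
  rewrite /gcdz /quad_a /quad_b -PoszD absz_nat; congr Posz; apply/gcdn_idPl.
  by rewrite dvdn_add // -?mulnn ?dvdn_mulr // -mulnA dvdn_mulr.
rewrite /HL_delta !discE !gcd2; congr (_ * _ * _).
rewrite big_seq_cond [RHS]big_seq_cond; apply: eq_bigl => p.
apply: andb_id2l; rewrite mem_primes => /and3P[pr _ pM]; congr (_ && _).
have pM' : (p %| M)%N by move: pM; rewrite absz_nat Euclid_dvdX // => /andP[].
have pb e : (p%:Z %| quad_b e)%Z by rewrite dvdzE /= dvdn_mulr // dvdn_mull.
by rewrite !pb.
Qed.

(** The main term common to the admissible classes. The shift is due to
    [HL_count] counting primes less than its argument, whereas the densities
    count primes up to theirs. *)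
Definition HL_scale (n : nat) : R :=
  HL_delta R quad_a (quad_b 0) (quad_c 0) * (Num.sqrt n.+1%:R / ln n.+1%:R).

Lemma class_primes_asymptotic (c : nat) : (c < M)%N -> admissible b Qs c ->
  (fun n => #|class_primes c n.+1|%:R / HL_scale n : R) @ \oo --> (1 : R).
Proof.
move=> cM adm.
have odd_c : ~~ (2 %| c ^ 2 + b ^ 2)%N.
  by rewrite -prime_coprime // coprime_sym (coprime_dvdr M_even adm).
have a_gt0 : 0 < quad_a by rewrite /quad_a ltz_nat expn_gt0 M_gt0.
have co : gcdz (gcdz quad_a (quad_b c)) (quad_c c) = 1.
  rewrite /gcdz !absz_nat; congr Posz; apply/eqP.
  rewrite -[_ == _]/(coprime _ _) coprime_sym.
  by apply: coprime_dvdr (dvdn_gcdl _ _) _; rewrite coprimeXr.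
have par : ~~ ((2 %| quad_a + quad_b c)%Z && (2 %| quad_c c)%Z).
  by rewrite negb_and orbC [(2 %| quad_c c)%Z]dvdzE odd_c.
have nsq : ~ (exists k : int, disc quad_a (quad_b c) (quad_c c) = k ^+ 2).
  case=> k; rewrite discE => kE; have := sqr_ge0 k; rewrite -kE oppr_ge0 leNgt.
  by rewrite !mulr_gt0 // exprn_gt0 // ltz_nat.
have := HL a_gt0 co par nsq; rewrite -(cvg_shiftS _ (nbhs (1 : R))) /=.
by under eq_fun do rewrite HL_count_class // (HL_delta_class c 0).
Qed.

(** A ratio that tends to 1 cannot have the denominator 0. *)
Lemma class_delta_neq0 (c : nat) : (c < M)%N -> admissible b Qs c ->
  HL_delta R quad_a (quad_b 0) (quad_c 0) != 0.
Proof.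
move=> cM adm; apply/eqP => d0; have := class_primes_asymptotic cM adm.
under eq_fun do rewrite /HL_scale d0 mul0r invr0 mulr0.
by move=> /cvg_lim -/(_ (@norm_hausdorff R R)); rewrite lim_cst // => /esym/eqP; rewrite oner_eq0.
Qed.

(** Otherwise the counting function of the class would vanish, and could not be
    asymptotic to the main term. *)
Lemma class_has_prime (c : nat) : admissible b Qs c ->
  exists x p : nat, [/\ (x = c %[mod M])%N, prime p & p = (x ^ 2 + b ^ 2)%N].
Proof.
move=> adm; apply: contrapT => none.
have cM : (c %% M < M)%N by rewrite ltn_pmod.
have admM : admissible b Qs (c %% M) by rewrite (@admissible_mod b Qs _ c) ?modn_mod.
have := class_primes_asymptotic cM admM.
have empty n : #|class_primes (c %% M) n| = 0%N.
  apply: eq_card0 => p; rewrite finset.inE; apply/negP => /andP[pr /asboolP[x [xc px]]].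
  by apply: none; exists x, p; split=> //; rewrite xc modn_mod.
under eq_fun do rewrite empty mul0r.
by move=> /cvg_lim -/(_ (@norm_hausdorff R R)); rewrite lim_cst // => /esym/eqP; rewrite oner_eq0.
Qed.

Lemma HL_scale_neq0 (c : nat) : (c < M)%N -> admissible b Qs c ->
  \forall n \near \oo, HL_scale n != 0.
Proof.
move=> cM adm; exists 1%N => // n /= n1.
apply: mulf_neq0; first exact: class_delta_neq0 cM adm.
apply: lt0r_neq0; rewrite divr_gt0 ?sqrtr_gt0 ?ltr0n //.
by rewrite ln_gt0 // ltr1n.
Qed.

(** A prime in a class that is not admissible divides the modulus. *)
Lemma card_class_primes_le (c n : nat) : ~~ admissible b Qs c ->
  (#|class_primes c n| <= M.+1)%N.
Proof.
move=> nadm; rewrite cardE -(size_map val) -[X in (_ <= X)%N](size_iota 0).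
apply: uniq_leq_size; first by rewrite (map_inj_uniq val_inj) enum_uniq.
move=> k /mapP[p]; rewrite mem_enum finset.inE => /andP[pr /asboolP[x [xc px]]] ->.
rewrite mem_iota /= add0n ltnS; apply: dvdn_leq => //.
apply: contraR nadm; rewrite -prime_coprime // px => co.
by rewrite -(admissible_mod b xc).
Qed.

Lemma bounded_over_scale_cvg0 (u : nat -> nat) (B : nat) (c : nat) :
    (c < M)%N -> admissible b Qs c -> (forall n, (u n <= B)%N) ->
  (fun n => (u n)%:R / HL_scale n : R) @ \oo --> (0 : R).
Proof.
move=> cM adm uB; apply/norm_cvg0P.
pose K := B%:R * `|HL_delta R quad_a (quad_b 0) (quad_c 0)|^-1.
have lim0 : (fun n => K * (ln n.+1%:R / Num.sqrt n.+1%:R)) @ \oo --> (0 : R).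
  by rewrite -(mulr0 K); apply: cvgMl_tmp; exact: ln_over_sqrt_cvg0.
apply: (squeeze_cvgr _ (cvg_cst 0) lim0); apply: nearW => n /=.
rewrite normr_ge0 /= /HL_scale normrM normfV normrM invfM -/K mulrA.
have q0 : 0 <= Num.sqrt n.+1%:R / ln n.+1%:R :> R.
  by rewrite divr_ge0 ?sqrtr_ge0 // ln_ge0 // ler1n.
rewrite [`|_ / _|]ger0_norm // invf_div ler_wpM2r //.
  by rewrite divr_ge0 ?sqrtr_ge0 // ln_ge0 // ler1n.
by rewrite ler_wpM2r ?invr_ge0 // normr_nat ler_nat.
Qed.

End ClassAsymptotics.

Lemma density_ratio (F : numFieldType) (A B s t k : F) :
    A != 0 -> t != 0 -> 4 * s = A - B -> B * t = A * k ->
  s / A = 4^-1 * (1 - k / t).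
Proof.
move=> A0 t0 sE BE; have four0 : 4 != 0 :> F by rewrite pnatr_eq0.
apply: (mulIf A0); apply: (mulfI four0); rewrite divfK // mulrA mulrA mulfV // mul1r sE.
by rewrite mulrBl mul1r mulrAC [k * A]mulrC -BE mulfK.
Qed.

Section Density.

Variables (R : realType) (b : nat) (D : int) (neg : bool) (sigma : nat).
Variables (ps qs ls : seq nat).

Let Qs := ps ++ qs ++ ls.
Let M := modulus Qs.

Hypothesis HL : Hardy_Littlewood_conjecture R.
Hypotheses (b_gt0 : (0 < b)%N) (even_b : ~~ odd b).
Hypotheses (Qs_prime : {in Qs, forall q, prime q /\ odd q}) (uQs : uniq Qs).
Hypothesis sigma02 : sigma = 0%N \/ sigma = 2%N.
Hypothesis D_def : D = (-1) ^+ neg *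
  (2 ^ sigma * \prod_(p <- ps) p * (\prod_(q <- qs) q) ^ 2
    * (\prod_(l <- ls) l) ^ 3)%N%:Z.

Let P := odd_part_primes ps ls b.
Let C (c : 'I_M) (n : nat) : {set 'I_n} := class_primes b Qs c n.
Let M_gt0 : (0 < M)%N. Proof. exact: modulus_gt0. Qed.

Lemma card_class_partition (n : nat) (S : {set 'I_n}) :
    (forall p, p \in S -> prime p /\ exists x : nat, p = (x ^ 2 + b ^ 2)%N :> nat) ->
  #|S| = (\sum_(c < M) #|S :&: C c n|)%N.
Proof.
move=> S_sq; rewrite -sum1_card big_mkcond /=.
have cardE c : #|S :&: C c n| = (\sum_p (p \in S) * (p \in C c n))%N.
  rewrite -sum1_card big_mkcond /=; apply: eq_bigr => p _.
  by rewrite finset.in_setI; case: (p \in S); case: (p \in C c n).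
rewrite (eq_bigr _ (fun c _ => cardE c)) exchange_big /=; apply: eq_bigr => p _.
rewrite -big_distrr /=; case: ifP => [pS|_] /=; last by rewrite mul0n.
have [pr [x px]] := S_sq p pS.
(* [p] determines [x], hence the class of [x]. *)
pose c0 : 'I_M := Ordinal (ltn_pmod x M_gt0).
rewrite mul1n (bigD1 c0) //= big1 => [|c cc0].
  rewrite addn0 finset.inE pr /=; case: asboolP => // -[].
  by exists x; rewrite modn_mod.
rewrite finset.inE; case: asboolP => [[y [yc py]]|_]; last by rewrite andbF.
case/eqP: cc0; apply: val_inj => /=; rewrite -(modn_small (ltn_ord c)) -yc.
have : (y ^ 2 == x ^ 2)%N by rewrite -(eqn_add2r (b ^ 2)) -py px.
by rewrite eqn_sqr => /eqP ->.
Qed.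

Section Sign.

Variable u : bool.

Let m : int := (-1) ^+ u * b%:Z.

Lemma in_Q (n : nat) (p : 'I_n.+1) : p \in Q m n ->
  prime p /\ exists x : nat, p = (x ^ 2 + b ^ 2)%N :> nat.
Proof.
rewrite finset.inE => /andP[pr /asboolP[x px]]; split=> //; exists `|x|%N.
apply/eqP; rewrite -eqz_nat px /m exprMn sqrr_sign mul1r -!mulnn !(PoszD, PoszM).
by rewrite -!expr2 abszE real_normK ?num_real // addrC.
Qed.

Lemma class_sub_Q (c : 'I_M) (n : nat) (p : 'I_n.+1) : p \in C c n.+1 -> p \in Q m n.
Proof.
rewrite !finset.inE => /andP[-> /asboolP[x [_ px]]] /=; apply/asboolP; exists x%:Z.
by rewrite px /m exprMn sqrr_sign mul1r -!mulnn !(PoszD, PoszM) -!expr2 addrC.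
Qed.

Let T (n : nat) : {set 'I_n.+1} :=
  [set p in Q m n | ~~ (p%:Z %| 2 * D)%Z && (frob_trace D p == 2 * m)]%SET.

Let signs := sign_classes b D ps qs ls u.

Lemma card_trace_class (c : 'I_M) (n : nat) : admissible b Qs c ->
  #|T n :&: C c n.+1| = ((c \in signs) * #|C c n.+1|)%N.
Proof.
move=> adm; have m2 : 2 * m = (-1) ^+ u * (2 * b%:Z) by rewrite /m mulrCA.
have [cS|cS] := boolP (c \in signs).
  rewrite mul1n; apply: eq_card => p; rewrite finset.in_setI andbC.
  have [pC|//] := boolP (p \in C c n.+1).
  rewrite [LHS]/= finset.inE (class_sub_Q pC).
  move: pC; rewrite finset.inE => /andP[pr /asboolP[x [xc px]]].
  have admx : admissible b Qs x by rewrite (admissible_mod b xc).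
  rewrite (admissible_ndvd_2D b_gt0 even_b D_def admx pr px) //= m2.
  move: cS; rewrite finset.inE => /andP[_ /asboolP sgn].
  by rewrite (class_sign_shared b_gt0 even_b Qs_prime sigma02 D_def sgn adm xc pr px) eqxx.
rewrite mul0n; apply: eq_card0 => p; rewrite finset.in_setI finset.inE.
apply/negP => /andP[/andP[_ /andP[_ /eqP fr]] pC].
move: pC; rewrite finset.inE => /andP[pr /asboolP[x [xc px]]].
case/negP: cS; rewrite finset.inE adm; apply/asboolP.
by exists x, (p : nat); split=> //; rewrite fr.
Qed.

(** Divide numerator and denominator by the main term of the conjecture: a class
    contributes 1 to the denominator if it is admissible, and 1 to the numerator
    if moreover it carries the sign [u]. The other classes contain boundedly many
    primes. *)
Lemma trace_density : dens_ratio R D m @ \oo -->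
  (4^-1 * (1 - (-1) ^+ count P Qs / (\prod_(q <- Qs | P q) tau_prime q)%N%:R) : R).
Proof.
have P_ndvd q : P q -> ~~ (q %| b)%N by case/andP.
have A_gt0 := count_admissible_gt0 even_b uQs Qs_prime.
have [c0 adm0] : exists c : 'I_M, admissible b Qs c.
  apply: contrapT => none; move: A_gt0; rewrite big1 // => c _.
  by case: (boolP (admissible _ _ _)) => // adm; case: none; exists c.
have cm0 := ltn_ord c0.
have scale0 := HL_scale_neq0 b_gt0 Qs_prime HL cm0 adm0.
have bounded v B := @bounded_over_scale_cvg0 R b Qs v B _ cm0 adm0.
have asym := class_primes_asymptotic b_gt0 Qs_prime HL.
have limC (c : 'I_M) : (fun n => #|C c n.+1|%:R / HL_scale R b Qs n : R) @ \oo -->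
    ((admissible b Qs c)%:R : R).
  have [adm|nadm] := boolP (admissible b Qs c); first exact: asym (ltn_ord c) adm.
  by apply: (bounded _ M.+1) => n; apply: card_class_primes_le.
have limT (c : 'I_M) : (fun n => #|T n :&: C c n.+1|%:R / HL_scale R b Qs n : R) @ \oo -->
    ((c \in signs)%:R : R).
  have [adm|nadm] := boolP (admissible b Qs c).
    under eq_fun do rewrite card_trace_class // natrM -mulrA.
    by have := cvgMl_tmp (a := (c \in signs)%:R) (asym _ (ltn_ord c) adm); rewrite mulr1; apply.
  rewrite (_ : (c \in signs) = false); last by rewrite finset.inE (negPf nadm).
  apply: (bounded _ M.+1) => n.
  apply: leq_trans (card_class_primes_le Qs_prime n.+1 nadm).
  by apply: subset_leq_card; exact: finset.subsetIr.
have sumA : \sum_(c < M) ((admissible b Qs c)%:R : R) =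
    (\sum_(c < M) (admissible b Qs c)%:R : int)%:~R.
  by rewrite rmorph_sum; apply: eq_bigr => c _; rewrite rmorph_nat.
have A0 : \sum_(c < M) ((admissible b Qs c)%:R : R) != 0.
  by rewrite sumA intr_eq0 gt_eqF.
have := ratio_of_sums_cvg scale0 limC limT A0.
have -> : (fun n => (\sum_(c < M) #|T n :&: C c n.+1|%:R) / \sum_(c < M) #|C c n.+1|%:R) =
    dens_ratio R D m.
  apply/funext => n; rewrite /dens_ratio -!natr_sum; congr (_%:R / _%:R).
    rewrite -card_class_partition // => p; rewrite finset.inE => /andP[pQ _].
    exact: in_Q pQ.
  rewrite (card_class_partition (S := Q m n)) => [|p]; last exact: in_Q.
  apply: eq_bigr => c _; rewrite (finset.setIidPr _) //.
  by apply/fintype.subsetP => p; exact: class_sub_Q.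
suff -> : (\sum_(c < M) ((c \in signs)%:R : R)) / \sum_(c < M) (admissible b Qs c)%:R =
  4^-1 * (1 - (-1) ^+ count P Qs / (\prod_(q <- Qs | P q) tau_prime q)%N%:R) by [].
have -> : \sum_(c < M) ((c \in signs)%:R : R) = #|signs|%:R.
  by rewrite -natr_sum -sum1_card [in RHS]big_mkcond /=; congr (_%:R); apply: eq_bigr => c _; case: (_ \in _).
have tau_neq0 : (\prod_(q <- Qs | P q) tau_prime q)%N%:R != 0 :> R.
  rewrite pnatr_eq0 -lt0n big_seq_cond prodn_cond_gt0 // => q /andP[/Qs_prime[pr oq] _].
  exact: tau_prime_gt0.
have card4 := card_sign_classesE b_gt0 even_b Qs_prime uQs sigma02 D_def
  (class_has_prime b_gt0 Qs_prime HL) u.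
have symb := sum_class_symbol even_b uQs Qs_prime P_ndvd.
have cardR : 4 * #|signs|%:R = (\sum_(c < M) (admissible b Qs c)%:R : int)%:~R -
    (\sum_(c < M) (admissible b Qs c)%:R * class_symbol b Qs P c)%:~R :> R.
  by rewrite -rmorphB /= -card4 rmorphM /= -pmulrn.
have symbR : (\sum_(c < M) (admissible b Qs c)%:R * class_symbol b Qs P c)%:~R *
    (\prod_(q <- Qs | P q) tau_prime q)%N%:R =
    (\sum_(c < M) (admissible b Qs c)%:R : int)%:~R * (-1) ^+ count P Qs :> R.
  rewrite -[(\prod_(q <- Qs | P q) _)%N%:R]/((\prod_(q <- Qs | P q) tau_prime q)%N%:Z%:~R).
  rewrite -rmorphM /= -[(\prod_(q <- Qs | P q) _)%N%:Z]natz natr_prod.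
  under [X in (_ * X)%:~R]eq_bigr do rewrite natz.
  by rewrite symb rmorphM /= rmorphXn rmorphN1.
rewrite sumA; apply: (density_ratio _ tau_neq0 cardR symbR).
by rewrite -sumA.
Qed.

End Sign.

End Density.

(** * Reading the factorizations *)

Lemma logn_prod_primes (rs : seq nat) (q : nat) :
    {in rs, forall p, prime p} -> uniq rs -> prime q ->
  logn q (\prod_(p <- rs) p)%N = (q \in rs).
Proof.
move=> + + prq; elim: rs => [|p rs IH] prs /=; first by rewrite big_nil logn1.
have prp := prs p (mem_head _ _).
have prs' : {in rs, forall r, prime r} by move=> r rrs; apply: prs; rewrite inE rrs orbT.
case/andP=> prs_p urs; rewrite big_cons lognM ?(prime_gt0 prp) //; last first.
  by rewrite big_seq prodn_cond_gt0 // => r /prs'; exact: prime_gt0.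
rewrite IH // inE logn_prime // eq_sym.
by case: (eqVneq q p) => [->|]; rewrite ?(negPf prs_p).
Qed.

Lemma logn_squarefree (n q : nat) : (0 < n)%N -> squarefree n ->
  logn q n = (q \in primes n).
Proof.
move=> n0 sqf; rewrite -logn_gt0; case E: (logn q n) => [|[|k]] //.
have prq : prime q by move: E; rewrite lognE; case: (prime q).
have : (q ^ 2 %| n)%N by rewrite pfactor_dvdn // E.
by move/sqf => q1; move: prq; rewrite q1.
Qed.

Unset Implicit Arguments.

Theorem theorem4p6 (R : realType)
    (HL : Hardy_Littlewood_conjecture R)
    (beta : nat) (beta_gt0 : (0 < beta)%N) (beta_even : ~~ odd beta)
    (* D = +- 2^sigma p_1...p_r (q_1...q_s)^2 (l_1...l_t)^3 *)
    (D : int) (neg : bool) (sigma : nat) (ps qs ls : seq nat)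
    (sigma_le3 : (sigma <= 3)%N)
    (pql_odd_prime : forall p : nat, p \in ps ++ qs ++ ls -> prime p /\ odd p)
    (pql_distinct : uniq (ps ++ qs ++ ls))
    (D_def : D = (-1) ^+ neg *
       (2 ^ sigma * \prod_(p <- ps) p * (\prod_(q <- qs) q) ^ 2
          * (\prod_(l <- ls) l) ^ 3)%N%:Z)
    (D_cond : ~~ (2 %| D)%Z \/ pow2_exactly_divides 2 D)
    (* D = d * dbar *)
    (d dbar : int)
    (D_split : D = d * dbar) (d_dbar_coprime : gcdz d dbar = 1)
    (d_gt0 : 0 < d) (d_odd : ~~ (2 %| d)%Z)
    (d_primes : forall p : nat, prime p -> (p%:Z %| d)%Z -> (p %| beta)%N)
    (dbar_primes : forall p : nat,
       prime p -> odd p -> (p%:Z %| dbar)%Z -> ~~ (p %| beta)%N)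
    (* dbar = +- 2^sigma dp dq^2 dl^3 *)
    (neg' : bool) (dp dq dl : nat)
    (dbar_def : dbar = (-1) ^+ neg' * (2 ^ sigma * dp * dq ^ 2 * dl ^ 3)%N%:Z)
    (dpql_gt0 : [/\ (0 < dp)%N, (0 < dq)%N & (0 < dl)%N])
    (dpql_odd : [/\ odd dp, odd dq & odd dl])
    (dpql_sqfree : [/\ squarefree dp, squarefree dq & squarefree dl])
    (dpql_coprime : [/\ coprime dp dq, coprime dp dl & coprime dq dl]) :
  let r := size ps in
  let t := size ls in
  let r'' := size (primes dp) in
  let t'' := size (primes dl) in
  let dens_pm_eq (v : R) :=
    dens_ratio R D beta%:Z @ \oo --> v /\
    dens_ratio R D (- beta%:Z) @ \oo --> v in
  [/\ d = 1 ->
        dens_pm_eq (4^-1 * (1 - (-1) ^+ (r + t) /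
          (tau ((\prod_(p <- ps) p) * (\prod_(l <- ls) l))%N)%:R)),
      (forall p : nat, prime p -> odd p -> ~~ (p%:Z %| dbar)%Z) ->
        dens_pm_eq 0
    & (exists p : nat, [/\ prime p, odd p & (p%:Z %| dbar)%Z]) ->
        dens_pm_eq (4^-1 * (1 - (-1) ^+ (r'' + t'') /
          (tau (dp * dl)%N)%:R))].
Proof.
move=> r t r'' t'' dens_pm_eq.
pose Qs := ps ++ qs ++ ls; pose P := odd_part_primes ps ls beta.
have ps_pr : {in ps, forall p, prime p} by move=> p pp; case: (pql_odd_prime p) => //; rewrite mem_cat pp.
have qs_pr : {in qs, forall p, prime p} by move=> p pp; case: (pql_odd_prime p) => //; rewrite !mem_cat pp orbT.
have ls_pr : {in ls, forall p, prime p} by move=> p pp; case: (pql_odd_prime p) => //; rewrite !mem_cat pp !orbT.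
have [ups [uqs uls]] : uniq ps /\ uniq qs /\ uniq ls.
  by move: pql_distinct; rewrite !cat_uniq => /and3P[-> _ /and3P[-> _ ->]].
have prod_gt0 rs : {in rs, forall p, prime p} -> (0 < \prod_(p <- rs) p)%N.
  by move=> rs_pr; rewrite big_seq prodn_cond_gt0 // => p /rs_pr; exact: prime_gt0.
have absD : `|D|%N = (2 ^ sigma * \prod_(p <- ps) p * (\prod_(q <- qs) q) ^ 2
    * (\prod_(l <- ls) l) ^ 3)%N by rewrite D_def abszMsign absz_nat.
have D_gt0 : (0 < `|D|)%N by rewrite absD !muln_gt0 !expn_gt0 /= !prod_gt0.
have lognD q : prime q -> logn q `|D|%N =
    (sigma * (q == 2) + (q \in ps) + 2 * (q \in qs) + 3 * (q \in ls))%N.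
  move=> prq; rewrite absD !lognM ?muln_gt0 ?expn_gt0 /= ?prod_gt0 // !lognX.
  rewrite !logn_prod_primes // logn_prime //; move: (_ \in ps) (_ \in qs) (_ \in ls).
  by clear; move=> i j k; rewrite !mulSn mul0n !addn0 !addnA.
have odd_Qs q : q \in Qs -> q != 2%N.
  by move=> /pql_odd_prime[_]; apply: contraTneq => ->.
have sigma02 : sigma = 0%N \/ sigma = 2%N.
  have log2 : logn 2 `|D|%N = sigma.
    have n2 : 2%N \notin Qs by apply/negP => /odd_Qs /eqP.
    move: n2; rewrite lognD // !mem_cat !negb_or => /and3P[/negPf -> /negPf -> /negPf ->].
    by rewrite eqxx !muln0 !addn0 muln1.
  have pow2 k : (2 ^ k %| `|D|)%N = (k <= sigma)%N.
    by rewrite -log2 -(@pfactor_dvdn 2 k _ isT D_gt0).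
  case: D_cond => [|/andP[]]; rewrite !dvdzE !absz_nat.
    by rewrite -[X in (X %| _)%N]/(2 ^ 1)%N pow2 -ltnNge ltnS leqn0 => /eqP; left.
  by rewrite !pow2 -ltnNge ltnS => s2 s2'; right; apply/eqP; rewrite eqn_leq s2 s2'.
(* The formula in terms of the odd primes with odd exponent in [D] that do not
   divide [beta]; it remains to name these primes in each case. *)
have dens_P : dens_pm_eq (4^-1 * (1 - (-1) ^+ size [seq q <- Qs | P q] /
    (\prod_(q <- [seq q <- Qs | P q]) tau_prime q)%N%:R)).
  have td u := trace_density HL beta_gt0 beta_even pql_odd_prime pql_distinct sigma02 D_def u.
  rewrite size_filter big_filter; split; first by have := td false; rewrite mul1r.
  by have := td true; rewrite expr1 mulN1r.
have Qs_P : {in ps ++ ls, forall q, [/\ q \in Qs, prime q, odd q & (q%:Z %| D)%Z]}.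
  move=> q qpl; have qQ : q \in Qs.
    by move: qpl; rewrite !mem_cat => /orP[] ->; rewrite ?orbT.
  have [prq oq] := pql_odd_prime q qQ; split=> //.
  rewrite dvdzE absz_nat -[q in (q %| _)%N]expn1 pfactor_dvdn // lognD //.
  by move: qpl; rewrite mem_cat => /orP[] ->; rewrite ?addn_gt0 ?orbT.
have mem_P q : (q \in [seq q <- Qs | P q]) = (q \in ps ++ ls) && ~~ (q %| beta)%N.
  rewrite mem_filter /P /odd_part_primes andbC; case: (boolP (q \in ps ++ ls)) => /=.
    by case/Qs_P => ->.
  by rewrite andbF.
have uP : uniq [seq q <- Qs | P q] by rewrite filter_uniq.
have dvd_dbar q : q \in ps ++ ls -> ~~ (q %| beta)%N -> (q%:Z %| dbar)%Z.
  case/Qs_P => _ prq oq; rewrite D_split !dvdzE absz_nat abszM Euclid_dvdM //.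
  case/orP => // qd qb; case/negP: qb; apply: d_primes => //; by rewrite dvdzE absz_nat.
split.
- move=> d1; have dbarD : dbar = D by rewrite D_split d1 mul1r.
  have all_P : {in ps ++ ls, forall q, ~~ (q %| beta)%N}.
    by move=> q /Qs_P[_ prq oq qD]; apply: dbar_primes => //; rewrite dbarD.
  have upl : uniq (ps ++ ls).
    rewrite cat_uniq ups uls andbT /=; apply/hasPn => q ql.
    move: pql_distinct; rewrite cat_uniq => /and3P[_ /hasPn psn _].
    by apply: psn; rewrite mem_cat ql orbT.
  have perm1 : perm_eq [seq q <- Qs | P q] (ps ++ ls).
    apply: uniq_perm => // q; rewrite mem_P.
    by case: (boolP (q \in ps ++ ls)) => //= /all_P ->.
  have perm2 : perm_eq (primes (\prod_(p <- ps) p * \prod_(l <- ls) l)) (ps ++ ls).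
    apply: uniq_perm; rewrite ?primes_uniq // => q; rewrite -logn_gt0 mem_cat.
    have [prq|nprq] := boolP (prime q).
      rewrite lognM ?prod_gt0 // !logn_prod_primes //.
      by case: (q \in ps); case: (q \in ls).
    rewrite lognE (negPf nprq) /=; apply/esym/negbTE/norP.
    by split; apply: contra nprq; [exact: ps_pr | exact: ls_pr].
  move: dens_P; rewrite (perm_size perm1) size_cat.
  by rewrite /tau (perm_big _ perm2) /= (perm_big _ perm1).
- move=> no_odd; have -> : 0 = 4^-1 * (1 - (-1) ^+ 0 / 1%:R) :> R.
    by rewrite expr0 divr1 subrr mulr0.
  have empty : [seq q <- Qs | P q] = [::].
    apply/eqP; rewrite -[_ == _]negbK -has_filter; apply/hasPn => q _.
    apply/negP => /andP[qpl qb]; have [_ prq oq _] := Qs_P q qpl.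
    by have := no_odd q prq oq; rewrite (dvd_dbar q qpl qb).
  by move: dens_P; rewrite empty big_nil.
move=> _; have [dp0 dq0 dl0] := dpql_gt0; have [odp odq odl] := dpql_odd.
have [sp sq sl] := dpql_sqfree; have [cpq cpl cql] := dpql_coprime.
have abs_dbar : `|dbar|%N = (2 ^ sigma * dp * dq ^ 2 * dl ^ 3)%N.
  by rewrite dbar_def abszMsign absz_nat.
have d0 : (0 < `|d|)%N by rewrite absz_gt0 gt_eqF.
have dbar0 : (0 < `|dbar|)%N by rewrite abs_dbar !muln_gt0 !expn_gt0 dp0 dq0 dl0.
have primes_split : perm_eq (primes (dp * dl)) (primes dp ++ primes dl).
  apply: uniq_perm; rewrite ?primes_uniq //.
    rewrite cat_uniq !primes_uniq andbT /=; apply/hasPn => q ql.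
    move: cpl; rewrite coprime_has_primes // => /hasPn; exact.
  by move=> q; rewrite mem_cat primesM.
(* [q] has the same exponent in [D] and in [dbar]; compare its parity. *)
have key q : prime q -> odd q -> ~~ (q %| beta)%N ->
    (q \in ps ++ ls) = (q \in primes (dp * dl)).
  move=> prq oq qb; have q2 : (q == 2%N) = false by apply/negbTE; apply: contraTneq oq => ->.
  have logd : logn q `|d|%N = 0%N.
    apply/eqP; rewrite -leqn0 leqNgt -[(0 < _)%N]pfactor_dvdn // expn1; apply: contra qb => qd.
    by apply: d_primes => //; rewrite dvdzE absz_nat.
  have := lognD q prq; rewrite D_split abszM lognM // logd abs_dbar.
  rewrite !lognM ?muln_gt0 ?expn_gt0 ?dp0 ?dq0 ?dl0 // !lognX logn_prime // q2.
  rewrite !logn_squarefree // (perm_mem primes_split) !mem_cat.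
  have : ~~ ((q \in ps) && (q \in ls)).
    apply/negP => /andP[qp ql]; move: pql_distinct; rewrite cat_uniq => /and3P[_ /hasPn/(_ q)].
    by rewrite mem_cat ql orbT qp => /(_ isT).
  have : ~~ ((q \in primes dp) && (q \in primes dl)).
    apply/negP => /andP[qp ql]; move: cpl; rewrite coprime_has_primes // => /hasPn/(_ q ql).
    by rewrite qp.
  by clear; do 6!case: (q \in _) => //=; lia.
have perm3 : perm_eq [seq q <- Qs | P q] (primes (dp * dl)).
  apply: uniq_perm; rewrite ?primes_uniq // => q; rewrite mem_P.
  apply/andP/idP => [[qpl qb]|qpr].
    by have [_ prq oq _] := Qs_P q qpl; rewrite -key.
  have : q \in primes dp ++ primes dl by rewrite -(perm_mem primes_split).
  rewrite mem_cat !mem_primes => qdd.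
  have prq : prime q by case/orP: qdd => /and3P[].
  have oq : odd q.
    by case/orP: qdd => /and3P[_ _ qd]; [apply: dvdn_odd qd odp | apply: dvdn_odd qd odl].
  have qdbar : (q%:Z %| dbar)%Z.
    rewrite dvdzE absz_nat abs_dbar; case/orP: qdd => /and3P[_ _ qd].
      by rewrite -!mulnA mulnCA dvdn_mulr.
    by rewrite dvdn_mull // expnS dvdn_mulr.
  have qb := dbar_primes q prq oq qdbar; split=> //; by rewrite key.
move: dens_P; rewrite (perm_size perm3) (perm_size primes_split) size_cat.
by rewrite (perm_big _ perm3).
Qed.
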